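(* Let $L\ge 1$ be an integer, let $\rho,\gamma_{th}>0$, and for $l=1,\dots,L$ let $\alpha_l>0$, $\beta_l>0$. Let $\gamma_1,\dots,\gamma_L$ be independent nonnegative random variables, where $\gamma_l$ has cumulative distribution function $F_{\gamma_l}(\gamma)=\frac{1}{1+(\gamma/(\rho\alpha_l))^{-\beta_l}}$ for $\gamma>0$, and let $\gamma_{SC}=\max\{\gamma_1,\dots,\gamma_L\}$. Then the outage probability $P_{out}=\Pr(\gamma_{SC}\le\gamma_{th})$ is $$P_{out}=H_{0,0:1,1;\dots;1,1}^{0,0:1,1;\dots;1,1}\left[\begin{matrix}\left(\frac{\gamma_{th}}{\rho\alpha_1}\right)^{\beta_1}\\ \vdots\\ \left(\frac{\gamma_{th}}{\rho\alpha_L}\right)^{\beta_L}\end{matrix}\;\middle|\;\begin{matrix}-:(1,1);\dots;(1,1)\\ -:(1,1);\dots;(1,1)\end{matrix}\right],$$ where the pairs $1,1$ and $(1,1)$ after each colon are repeated $L$ times and $H$ is the multivariate Fox H-function. In the special case $\alpha_l=\alpha$, $\beta_l=\beta$ for all $l$, $$P_{out}=\frac{1}{\left[1+\left(\frac{\gamma_{th}}{\rho\alpha}\right)^{-\beta}\right]^{L}}.$$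
   Context: The multivariate Fox H-function in the claim, at arguments $x_1,\dots,x_L>0$, is the $L$-fold Mellin–Barnes integral $$H_{0,0:1,1;\dots;1,1}^{0,0:1,1;\dots;1,1}[\cdots]=\left(\frac{1}{2\pi i}\right)^L\int_{c_1}\cdots\int_{c_L}\prod_{l=1}^L\Gamma(1-s_l)\Gamma(s_l)\,x_l^{s_l}\;ds_1\cdots ds_L,$$ where $c_l$ is a vertical line $\mathrm{Re}\,s_l=\sigma_l$ with $0<\sigma_l<1$ (separating the poles of $\Gamma(s_l)$ from those of $\Gamma(1-s_l)$), traversed upward. Here $x_l=(\gamma_{th}/(\rho\alpha_l))^{\beta_l}$. In the application, $\gamma_l$ is the SNR of the $l$-th branch of a selection combining receiver, $\rho$ is the average transmit SNR and $\gamma_{th}$ is an outage threshold. *)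

(* Defs.v *)
From HB Require Import structures.
From mathcomp Require Import all_boot all_order all_algebra.
From mathcomp Require Import all_classical all_reals all_analysis.
From mathcomp Require Export complex.

Set Implicit Arguments.
Unset Strict Implicit.
Unset Printing Implicit Defensive.

Import Order.TTheory GRing.Theory Num.Theory.
Import numFieldNormedType.Exports.

Local Open Scope classical_set_scope.
Local Open Scope ring_scope.

Definition cexp (R : realType) (z : R[i]) : R[i] :=
  Complex (expR (complex.Re z) * cos (complex.Im z))
          (expR (complex.Re z) * sin (complex.Im z)).

(* [x ^ s = exp (s * ln x)]; meaningful for [0 < x] only. *)
Definition cpow (R : realType) (x : R) (s : R[i]) : R[i] :=
  cexp (s * (ln x)%:C%C).

Definition cintegral (R : realType) (D : set R) (f : R -> R[i]) : R[i] :=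
  Complex (\int[lebesgue_measure]_(t in D) complex.Re (f t))
          (\int[lebesgue_measure]_(t in D) complex.Im (f t)).

(* The integral of [f s ds] over the line [Re s = sigma], traversed upward:
   [s = sigma + i t] and [ds = i dt]. *)
Definition vline_integral (R : realType) (sigma : R) (f : R[i] -> R[i])
    : R[i] :=
  'i%C * cintegral setT (fun t => f (Complex sigma t)).

(* The integral over the line of the first variable is the outermost one. *)
Fixpoint iter_vline_integral (R : realType) (L : nat) :
    ('I_L -> R) -> (('I_L -> R[i]) -> R[i]) -> R[i] :=
  match L with
  | 0 => fun _ f => f (fun _ => 0)
  | L'.+1 => fun sigma f =>
      vline_integral (sigma ord0) (fun s0 =>
        iter_vline_integral (fun l : 'I_L' => sigma (lift ord0 l))
          (fun s => f (fun l => oapp s s0 (unlift ord0 l))))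
  end.

Definition Gamma_Euler (R : realType) (z : R[i]) : R[i] :=
  cintegral `]0, +oo[ (fun t => cpow t (z - 1) * (expR (- t))%:C%C).

(* The Gamma function on the complex plane, continued to [Re z <= 0] by
   [Gamma z = Gamma (z + n) / (z (z + 1) ... (z + n - 1))], where [n] is the
   least natural number with [0 < Re z + n].  Since [x / 0 = 0], its value at a
   pole is [0], so that [(Gamma z)^-1] has its correct value [0] there. *)
Definition cGamma (R : realType) (z : R[i]) : R[i] :=
  let n := if 0 < complex.Re z then 0%N
           else (Num.truncn (- complex.Re z)).+1 in
  Gamma_Euler (z + n%:R) / \prod_(k < n) (z + k%:R).

(* The Mellin-Barnes kernel of one variable, with orders [m, n] and parameters
   [c = (c_j, C_j)_{j <= p}] and [d = (d_j, D_j)_{j <= q}]. *)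
Definition foxH_kernel (R : realType) (mn : nat * nat) (c d : seq (R[i] * R))
    (s : R[i]) : R[i] :=
  let: (m, n) := mn in
  (\prod_(q <- take m d) cGamma (q.1 - q.2%:C%C * s)
   * \prod_(q <- take n c) cGamma (1 - q.1 + q.2%:C%C * s))
  / (\prod_(q <- drop m d) cGamma (1 - q.1 + q.2%:C%C * s)
     * \prod_(q <- drop n c) cGamma (q.1 - q.2%:C%C * s)).

(* The factor coupling the variables, with order [n] and parameters
   [a = (a_j; A_j^(1), ..., A_j^(L))_{j <= p}] and
   [b = (b_j; B_j^(1), ..., B_j^(L))_{j <= q}]. *)
Definition foxH_coupling (R : realType) (L n : nat)
    (a b : seq (R[i] * ('I_L -> R))) (s : 'I_L -> R[i]) : R[i] :=
  let w (q : R[i] * ('I_L -> R)) := \sum_(l < L) (q.2 l)%:C%C * s l in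
  (\prod_(q <- take n a) cGamma (1 - q.1 + w q))
  / (\prod_(q <- drop n a) cGamma (q.1 - w q)
     * \prod_(q <- b) cGamma (1 - q.1 + w q)).

(* The multivariate Fox H-function
     H^{0,n:m_1,n_1;...;m_L,n_L}_{p,q:p_1,q_1;...;p_L,q_L}
       [x | a : c_1; ...; c_L | b : d_1; ...; d_L]
   at positive arguments [x].  The numbers [p, q, p_l, q_l] are the lengths of
   [a, b, c l, d l].  The [l]-th contour is the line [Re s_l = sigma l], which
   must separate the poles of the numerator factors [Gamma (d_j - D_j s_l)] from
   those of the other numerator factors. *)
Definition foxH (R : realType) (L : nat)
    (n : nat) (mn : 'I_L -> nat * nat)
    (a : seq (R[i] * ('I_L -> R))) (c : 'I_L -> seq (R[i] * R))
    (b : seq (R[i] * ('I_L -> R))) (d : 'I_L -> seq (R[i] * R))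
    (sigma : 'I_L -> R) (x : 'I_L -> R) : R[i] :=
  ((2 * pi)%:C%C * 'i%C) ^- L
  * iter_vline_integral sigma (fun s =>
      foxH_coupling n a b s
      * \prod_(l < L) (foxH_kernel (mn l) (c l) (d l) (s l)
                       * cpow (x l) (s l))).

Definition mutually_independent d (T : measurableType d) (R : realType)
    (P : probability T R) (L : nat) (X : 'I_L -> {RV P >-> R}) : Prop :=
  forall (J : {set 'I_L}) (A : 'I_L -> set R),
    (forall l, measurable (A l)) ->
    (P (\bigcap_(l in [set` J]) (X l @^-1` A l))
     = \prod_(l in J) P (X l @^-1` A l))%E.

(* The largest branch; the default value [0] of the iterated maximum plays no
   role when [0 < L] and the [X l] are nonnegative. *)
Definition selection_combining (T : Type) (R : realType) (L : nat)
    (X : 'I_L -> T -> R) (t : T) : R :=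
  \big[Num.max/0]_(l < L) X l t.

(* Main.v *)
Require Import Defs.
From mathcomp Require Import all_boot all_order all_algebra.
From mathcomp Require Import all_classical all_reals all_analysis.
From mathcomp Require Import complex.
From mathcomp Require Import measurable_realfun.
From mathcomp Require Import ring lra.

Set Implicit Arguments.
Unset Strict Implicit.
Unset Printing Implicit Defensive.

Import Order.TTheory GRing.Theory Num.Theory.
Import numFieldNormedType.Exports.

Local Open Scope classical_set_scope.
Local Open Scope ring_scope.

(* Each kernel of the H-function is [Gamma (1 - s) * Gamma s], so the iterated
   integral factors into [L] copies of
     1 / (2 pi i) * \int Gamma s * Gamma (1 - s) * x ^ s ds = x / (1 + x).
   Writing [Gamma (1 - s)] as the integral of [v ^ (- s) * exp (- v)] and exchanging
   the integrals reduces this to Mellin inversion for the Gamma function,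
     1 / (2 pi i) * \int Gamma s * w ^ (- s) ds = exp (- w) with w = v / x,
   since then \int_0^oo exp (- v - v / x) dv = x / (1 + x).  Two integrations by parts
   give [Gamma (a + i t) = O(1 / (1 + t ^ 2))], so everything converges absolutely.
   The inversion itself is obtained by Abel summation, that is, from the factor
   [exp (- e t)] as [e] tends to [0]: integrating in [t] first produces the Poisson
   kernel [e / (e ^ 2 + (ln u - ln w) ^ 2)], the derivative of an arctangent, so that
   another integration by parts turns the approximate identity into dominated
   convergence. *)

(** * Integration on half-lines *)

Section integration_tools.
Context {R : realType}.
Notation mu := (@lebesgue_measure R).
Implicit Types (f F g h : R -> R) (a b l M : R).

Lemma is_derive_FTC2 f F a b : a < b ->
  (forall x, a <= x <= b -> is_derive x (1 : R) F (f x)) ->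
  (forall x, a <= x <= b -> {for x, continuous f}) ->
  (\int[mu]_(x in `[a, b]) (f x)%:E = (F b - F a)%:E)%E.
Proof.
move=> ab dF cf.
have cF x : a <= x <= b -> {for x, continuous F}.
  move=> /dF dFx; apply: differentiable_continuous.
  by apply/derivable1_diffP; exact: ex_derive.
rewrite (@continuous_FTC2 _ f F)// ?EFinB//.
- apply: continuous_in_subspaceT => x /set_mem/=; rewrite in_itv/=; exact: cf.
- split.
  + move=> x; rewrite in_itv/= => /andP[ax xb].
    by have := dF x; rewrite !ltW// => /(_ isT) ?; exact: ex_derive.
  + by apply: cvg_at_right_filter; apply: cF; rewrite lexx ltW.
  + by apply: cvg_at_left_filter; apply: cF; rewrite lexx ltW.
- move=> x; rewrite in_itv/= => /andP[ax xb].
  by have := dF x; rewrite !ltW// => /(_ isT) ?; rewrite derive1E; exact: derive_val.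
Qed.

(** Compact intervals that increase to []a, +oo[]. The index [n.+2] instead of [n.+1] keeps the left
    end strictly below the right end already at [n = 0]. *)
Let itvn a n : set R := `[a + n.+2%:R^-1, a + n.+2%:R].

Let itvn_lt a n : a + n.+2%:R^-1 < a + n.+2%:R.
Proof.
by rewrite ltrD2l (@lt_trans _ _ 1)// ?invf_lt1// ?ltr1n.
Qed.

Let itvn_gt a n x : itvn a n x -> a < x.
Proof. by rewrite /itvn/= in_itv/= => /andP[+ _]; apply: lt_le_trans; rewrite ltrDl. Qed.

Let itvn_bigcup a : \bigcup_n itvn a n = `]a, +oo[%classic.
Proof.
apply/seteqP; split => [x [n _ /itvn_gt]|x]/=; first by rewrite in_itv/= andbT.
rewrite in_itv/= andbT => ax.
have xa0 : 0 < x - a by rewrite subr_gt0.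
pose n := maxn (Num.truncn (x - a)).+1 (Num.truncn (x - a)^-1).+1.
exists n => //; rewrite /itvn/= in_itv/= -lerBrDl -[X in _ && X]lerBlDl.
have h (y : R) : 0 <= y -> ((Num.truncn y).+1 <= n)%N -> y <= n.+2%:R.
  move=> y0 yn; rewrite ltW// (lt_le_trans (truncnS_gt y))// ler_nat.
  by rewrite (leq_trans yn)// !leqW.
apply/andP; split; last by apply: h; rewrite ?leq_maxl// ltW.
rewrite invf_ple ?posrE//.
by apply: h; rewrite ?leq_maxr// invr_ge0 ltW.
Qed.

Let itvn_nd a : nondecreasing_seq (itvn a).
Proof.
apply/nondecreasing_seqP => n; rewrite subsetEset => x; rewrite /itvn/= !in_itv/= => /andP[p q].
rewrite (le_trans _ p) ?(le_trans q)// lerD2l ?ler_nat//.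
by rewrite lef_pV2 ?posrE// ler_nat.
Qed.

Lemma continuous_measurable_itvoy f a :
  (forall x, a < x -> {for x, continuous f}) -> measurable_fun `]a, +oo[ f.
Proof.
move=> cf; apply: open_continuous_measurable_fun => //.
by move=> x /set_mem/=; rewrite in_itv/= andbT => /cf.
Qed.

Let itvn_FTC2 f F a n :
  (forall x, a < x -> is_derive x (1 : R) F (f x)) ->
  (forall x, a < x -> {for x, continuous f}) ->
  (\int[mu]_(x in itvn a n) (f x)%:E =
   (F (a + n.+2%:R) - F (a + n.+2%:R^-1))%:E)%E.
Proof.
move=> dF cf; apply: is_derive_FTC2 => [|x xn|x xn]; first exact: itvn_lt.
- by apply: dF; apply: (@itvn_gt _ n); rewrite /itvn/= in_itv.
- by apply: cf; apply: (@itvn_gt _ n); rewrite /itvn/= in_itv.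
Qed.

(** Monotone convergence along the intervals [itvn a n]: on each of them the fundamental theorem of
    calculus gives a difference of two values of [F], hence at most [M + M]. *)
Lemma integrable_derive_ge0 f F a M :
  (forall x, a < x -> is_derive x (1 : R) F (f x)) ->
  (forall x, a < x -> {for x, continuous f}) ->
  (forall x, a < x -> 0 <= f x) ->
  (forall x, a < x -> `|F x| <= M) ->
  mu.-integrable `]a, +oo[ (EFin \o f).
Proof.
move=> dF cf f0 FM.
have mf := continuous_measurable_itvoy cf.
apply/integrableP; split; first exact/measurable_EFinP.
have -> : (\int[mu]_(x in `]a, +oo[) `|(EFin \o f) x| =
             \int[mu]_(x in `]a, +oo[) (EFin \o f) x)%E.
  apply: eq_integral; move=> x /set_mem/=; rewrite in_itv/= andbT => /f0 fx0.
  by rewrite /= ger0_norm.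
have mItvn n : measurable_fun (itvn a n) (EFin \o f).
  apply/measurable_EFinP; apply: measurable_funS mf => //.
  by move=> x /itvn_gt; rewrite /= in_itv/= andbT.
have : (\int[mu]_(x in itvn a n) (EFin \o f) x @[n --> \oo] -->
        \int[mu]_(x in \bigcup_n itvn a n) (EFin \o f) x)%E.
  apply: ge0_nondecreasing_set_cvg_integral => //; first by move=> n; exact: measurable_itv.
  by move=> n x /itvn_gt; exact: f0.
rewrite itvn_bigcup => cI.
apply: (@le_lt_trans _ _ (M + M)%:E); last exact: ltry.
rewrite -(cvg_lim _ cI)//; apply: lime_le; first by apply/cvg_ex; eexists; exact: cI.
apply: nearW => n /=.
rewrite (itvn_FTC2 n dF cf) lee_fin (le_trans (ler_norm _))// (le_trans (ler_normB _ _))//.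
by rewrite lerD// FM// ltrDl.
Qed.

Lemma dominated_cvg_Rintegral d (T : measurableType d) (m : {measure set T -> \bar R})
    (D : set T) (f_ : (T -> R)^nat) (f g : T -> R) : measurable D ->
  (forall n, measurable_fun D (f_ n)) -> measurable_fun D f ->
  {ae m, forall x, D x -> f_ ^~ x @ \oo --> f x} ->
  m.-integrable D (EFin \o g) ->
  (forall n x, D x -> `|f_ n x| <= g x) ->
  (\int[m]_(x in D) f_ n x)%R @[n --> \oo] --> (\int[m]_(x in D) f x)%R.
Proof.
move=> mD mf_ mf f_f ig fg.
have [] := @dominated_convergence _ _ R m D mD (fun n => EFin \o f_ n) (EFin \o f) (EFin \o g).
- by move=> n; exact/measurable_EFinP.
- exact/measurable_EFinP.
- by apply: filterS f_f => x h Dx; apply/cvg_EFin; [exact: nearW|exact: h].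
- exact: ig.
- by apply: aeW => x n Dx; rewrite lee_fin fg.
move=> intf _ cvgf; apply: fine_cvg.
by rewrite fineK//; exact: integrable_fin_num.
Qed.

(** Both sides are limits of the same sequence. Dominated convergence, with [|f|] as the bound,
    handles the integrals over [itvn a n], and the fundamental theorem of calculus turns these into
    differences of values of [F] whose arguments tend to [+oo] and to [a] from the right. *)
Lemma Rintegral_derive_itvoy f F a la ly :
  (forall x, a < x -> is_derive x (1 : R) F (f x)) ->
  (forall x, a < x -> {for x, continuous f}) ->
  mu.-integrable `]a, +oo[ (EFin \o f) ->
  F x @[x --> a^'+] --> la -> F x @[x --> +oo] --> ly ->
  \int[mu]_(x in `]a, +oo[) f x = ly - la.
Proof.
move=> dF cf intf Fa Fy.
have mf := continuous_measurable_itvoy cf.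
have := @dominated_cvg_Rintegral _ _ mu `]a, +oo[%classic (fun n => f \_ (itvn a n)) f (fun x => `|f x|).
have -> : (fun n => \int[mu]_(x in `]a, +oo[) (f \_ (itvn a n)) x) =
    (fun n => F (a + n.+2%:R) - F (a + n.+2%:R^-1)).
  apply/funext => n; rewrite -Rintegral_mkcondr setIidr; last first.
    by move=> x /itvn_gt; rewrite /= in_itv/= andbT.
  by rewrite /Rintegral (itvn_FTC2 n dF cf).
move=> H; apply: (cvg_unique (@Rhausdorff R) (H _ _ _ _ _ _)) => //.
- move=> n; apply/measurable_restrict => //; first exact: measurable_itv.
  by apply: (measurable_funS _ _ mf) => //; exact: subIsetl.
(* Each point lies in some [itvn a n] and, by monotonicity, in all later ones, so the truncated
   functions are eventually constant there. *)
- apply: aeW => x Dx; apply: (@cvg_near_cst _ _ _ _ _).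
  have : (\bigcup_n itvn a n) x by rewrite itvn_bigcup.
  move=> [n _ xn]; exists n => // m /= nm.
  rewrite patchE mem_set//.
  by have /subsetPset := itvn_nd a nm; apply.
- exact: (integrable_norm intf).
- by move=> n x _; rewrite patchE; case: ifPn => // _; rewrite normr0.
apply: cvgB.
  apply: (cvg_comp _ _ _ Fy).
  apply/cvgryPge => A; near=> n; rewrite -lerBlDl.
  have : (Num.truncn (A - a) < n)%N by near: n; exact: nbhs_infty_gt.
  move=> hn; rewrite ltW// (lt_le_trans (truncnS_gt _))// ler_nat.
  by rewrite (leq_trans hn)// !leqW.
move/cvg_at_rightP : Fa; apply; split=> [n|]; first by rewrite ltrDl.
rewrite -[X in _ --> X]addr0; apply: cvgD; first exact: cvg_cst.
by have := @cvg_harmonic R; rewrite -cvg_shiftS.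
Unshelve. all: by end_near. Qed.
End integration_tools.

Lemma integrable_norm_le {R : realType} d (T : measurableType d)
    (m : {measure set T -> \bar R}) (D : set T) (f g : T -> R) :
  measurable D -> measurable_fun D f -> m.-integrable D (EFin \o g) ->
  (forall x, D x -> `|f x| <= g x) -> m.-integrable D (EFin \o f).
Proof.
move=> mD mf ig fg; apply: (le_integrable mD _ _ ig); first exact/measurable_EFinP.
by move=> x Dx /=; rewrite lee_fin (le_trans (fg _ Dx))// ler_norm.
Qed.

(** * Exchange of iterated integrals under a product bound *)

Section exchange.
Context {R : realType} d1 d2 (T1 : measurableType d1) (T2 : measurableType d2).
Variables (m1 : {sigma_finite_measure set T1 -> \bar R}).
Variables (m2 : {sigma_finite_measure set T2 -> \bar R}).
Variables (A : set T1) (B : set T2) (f : T1 * T2 -> R) (g : T1 -> R) (h : T2 -> R).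
Hypotheses (mA : measurable A) (mB : measurable B).
Hypothesis mf : measurable_fun [set: T1 * T2] f.
Hypothesis ig : m1.-integrable A (EFin \o g).
Hypothesis ih : m2.-integrable B (EFin \o h).
Hypothesis fgh : forall x y, A x -> B y -> `|f (x, y)| <= g x * h y.

(** Extension by zero from [A * B] to the whole product space, where the Fubini theorem applies. *)
Let f' (z : T1 * T2) : \bar R := ((f \_ (A `*` B)) z)%:E.

Let mf' : measurable_fun [set: T1 * T2] f'.
Proof.
apply/measurable_EFinP; apply/(measurable_restrictT f) => //.
  exact: measurableX.
exact: measurable_funTS.
Qed.

Let integrable_section1 x : A x -> m2.-integrable B (fun y => (f (x, y))%:E).
Proof.
move=> Ax; apply: (@integrable_norm_le _ _ _ m2 B _ (fun y => g x * h y)) => //.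
- apply: measurable_funTS; apply: (measurableT_comp mf).
  exact: measurable_pair1.
- exact: (integrableZl mB (g x) ih).
- by move=> y; exact: fgh.
Qed.

Let integrable_section2 y : B y -> m1.-integrable A (fun x => (f (x, y))%:E).
Proof.
move=> By; apply: (@integrable_norm_le _ _ _ m1 A _ (fun x => g x * h y)) => //.
- apply: measurable_funTS; apply: (measurableT_comp mf).
  exact: measurable_pair2.
- exact: (integrableZr mA (h y) ig).
- by move=> x Ax; exact: fgh.
Qed.

Let F'E x : (\int[m2]_y f' (x, y) =
  ((fun x => \int[m2]_(y in B) f (x, y)) \_ A x)%:E)%E.
Proof.
rewrite /f' patchE; case: ifPn => [/set_mem Ax|Ax].
  rewrite /Rintegral fineK; last exact: (integrable_fin_num _ (integrable_section1 Ax)).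
  rewrite [RHS]integral_mkcond; apply: eq_integral => y _.
  rewrite !patchE; case: ifPn => [/set_mem/= [_ By]|]; first by rewrite mem_set.
  case: ifPn => // /set_mem By /negP[]; exact/mem_set.
rewrite integral0_eq// => y _; rewrite patchE ifF//.
by apply/negbTE; apply: contra Ax => /set_mem[/= Ax _]; exact/mem_set.
Qed.

Let G'E y : (\int[m1]_x f' (x, y) =
  ((fun y => \int[m1]_(x in A) f (x, y)) \_ B y)%:E)%E.
Proof.
rewrite /f' patchE; case: ifPn => [/set_mem By|By].
  rewrite /Rintegral fineK; last exact: (integrable_fin_num _ (integrable_section2 By)).
  rewrite [RHS]integral_mkcond; apply: eq_integral => x _.
  rewrite !patchE; case: ifPn => [/set_mem/= [Ax _]|]; first by rewrite mem_set.
  case: ifPn => // /set_mem Ax /negP[]; exact/mem_set.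
rewrite integral0_eq// => x _; rewrite patchE ifF//.
by apply/negbTE; apply: contra By => /set_mem[/= _ By]; exact/mem_set.
Qed.

(** By Tonelli it is enough to bound the iterated integral of the absolute value. Since [g x * h y]
    is at most its own absolute value, that integral is at most the product of the integrals of
    [|g|] and [|h|]. *)
Let if' : (product_measure1 m1 m2).-integrable [set: T1 * T2] f'.
Proof.
apply/(@integrable12ltyP _ _ _ _ _ m1 m2 f' mf').
have ih' : (\int[m2]_(y in B) `|(h y)%:E| < +oo)%E by case/integrableP : ih.
have ig' : (\int[m1]_(x in A) `|(g x)%:E| < +oo)%E by case/integrableP : ig.
set Ch := (\int[m2]_(y in B) `|(h y)%:E|)%E in ih'.
have Chfin : Ch \is a fin_num by rewrite ge0_fin_numE// /Ch integral_ge0.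
have mh : measurable_fun B (fun y => `|(h y)%:E|%E).
  by apply: measurableT_comp => //; exact: measurable_int ih.
apply: (@le_lt_trans _ _ (\int[m1]_(x in A) (`|(g x)%:E| * Ch))%E).
  rewrite [leRHS]integral_mkcond; apply: ge0_le_integral => //.
  - by move=> x _; exact: integral_ge0.
  - apply: (measurable_fun_fubini_tonelli_F (abse \o f')).
      exact: measurableT_comp.
    by move=> z; exact: abse_ge0.
  - apply: (measurable_restrictT _ mA).1.
    apply: emeasurable_funM => //; apply: measurableT_comp => //.
    exact: measurable_int ig.
  move=> x _; rewrite patchE; case: ifPn => [/set_mem Ax|Ax].
    rewrite /Ch -ge0_integralZl//.
    rewrite [leRHS]integral_mkcond; apply: ge0_le_integral => //.
    - do 2 apply: measurableT_comp => //.
    - apply: (measurable_restrictT _ mB).1.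
      by apply: emeasurable_funM.
    move=> y _; rewrite /f' !patchE; case: ifPn => [/set_mem/= [_ By]|].
      rewrite mem_set// -EFinM -normrM lee_fin (le_trans (fgh Ax By))//.
      exact: ler_norm.
    by move=> _; case: ifPn => _; rewrite /= normr0 // lee_fin mulr_ge0.
  rewrite integral0_eq// => y _; rewrite /f' patchE ifF /= ?normr0//.
  by apply/negbTE; apply: contra Ax => /set_mem[/= Ax _]; exact/mem_set.
have Ch0 : (0 <= Ch)%E by exact: integral_ge0.
rewrite ge0_integralZr//.
  apply: lte_mul_pinfty => //; first exact: integral_ge0.
  by rewrite ge0_fin_numE// integral_ge0.
by apply: measurableT_comp => //; exact: measurable_int ig.
Qed.

Lemma integrable_Rintegral_section :
  m1.-integrable A (fun x => (\int[m2]_(y in B) f (x, y))%:E).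
Proof.
have := integrable_fubini_F if'.
rewrite /fubini_F; under eq_fun do rewrite F'E.
by move=> H; apply/(integrable_mkcond _ mA); rewrite restrict_EFin.
Qed.

Lemma Rintegral_exchange :
  \int[m1]_(x in A) \int[m2]_(y in B) f (x, y) =
  \int[m2]_(y in B) \int[m1]_(x in A) f (x, y).
Proof.
rewrite [LHS]Rintegral_mkcond [RHS]Rintegral_mkcond /Rintegral.
transitivity (fine (\int[m1]_x \int[m2]_y f' (x, y))%E).
  by congr fine; apply: eq_integral => x _; rewrite F'E.
rewrite (Fubini if').
by congr fine; apply: eq_integral => y _; rewrite G'E.
Qed.
End exchange.

(** * Reflection, even and odd integrands on the real line *)

Section reflection.
Context {R : realType}.
Notation mu := (@lebesgue_measure R).
Implicit Types (f : R -> R).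

(** Lebesgue measure equals its own pushforward under negation, so this is the change of variables
    formula for pushforward measures. *)
Lemma Rintegral_opp f (A : set R) : measurable A ->
  mu.-integrable [set: R] (EFin \o f) ->
  \int[mu]_(x in A) f x = \int[mu]_(x in -%R @^-1` A) f (- x).
Proof.
move=> mA intf; rewrite /Rintegral; congr fine.
have mN : measurable_fun [set: measurableTypeR R] (-%R : _ -> measurableTypeR R).
  exact: oppr_measurable.
transitivity (\int[pushforward mu (-%R : _ -> measurableTypeR R)]_(x in A) (f x)%:E)%E.
  by apply: eq_measure_integral => //= B mB _; rewrite lebesgue_measureN.
rewrite (@integral_pushforward _ _ _ _ R _ mN mu A (EFin \o f))//.
- exact: measurable_int intf.
have mf := measurable_int mu intf.
apply: (@integrableS _ _ _ mu setT) => //.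
  by rewrite -[_ @^-1` _]setTI; exact: mN.
apply/integrableP; split; first exact: (measurableT_comp mf mN).
case/integrableP : intf => _; apply: le_lt_trans.
have := @ge0_integral_pushforward _ _ _ _ R _ mN mu setT (fun x => `|(f x)%:E|%E).
rewrite preimage_setT /comp => <- //.
- rewrite (_ : (\int[pushforward _ _]_(y in _) _)%E = \int[mu]_x `|(f x)%:E|)%E//.
  by apply: eq_measure_integral => //= B mB _; rewrite lebesgue_measureN.
- exact: measurableT_comp.
Qed.
End reflection.

Section symmetric_integrals.
Context {R : realType}.
Notation mu := (@lebesgue_measure R).
Implicit Types (f : R -> R).

Lemma Rintegral_odd f : mu.-integrable [set: R] (EFin \o f) ->
  (forall x, f (- x) = - f x) -> \int[mu]_x f x = 0.
Proof.
move=> intf fN; have := Rintegral_opp measurableT intf.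
rewrite preimage_setT; under [in X in _ = X -> _]eq_Rintegral do rewrite fN -mulN1r.
by rewrite RintegralZl// mulN1r; lra.
Qed.

Lemma Rintegral_even f : mu.-integrable [set: R] (EFin \o f) ->
  (forall x, f (- x) = f x) -> \int[mu]_x f x = 2 * \int[mu]_(x in `]0, +oo[) f x.
Proof.
move=> intf fN.
have intS (A : set R) : measurable A -> mu.-integrable A (EFin \o f).
  by move=> mA; apply: (@integrableS _ _ _ mu setT).
have -> : [set: R] = `]-oo, 0] `|` `]0, +oo[.
  apply/seteqP; split => // x _ /=; rewrite !in_itv/= andbT.
  by case: (leP x 0) => _; [left|right].
rewrite Rintegral_setU//; last 2 first.
  by apply: intS; exact: measurableU.
  by apply/disj_setPS => x [/=]; rewrite !in_itv/= andbT leNgt => /negbTE ->.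
rewrite (@Rintegral_opp _ f `]-oo, 0])//; under eq_Rintegral do rewrite fN.
have -> : -%R @^-1` `]-oo, 0] = `[0, +oo[%classic :> set R.
  by apply/seteqP; split => x /=; rewrite !in_itv/= ?andbT oppr_le0.
(* The point 0 was put in the left half; it is a null set, so the reflected half [[0, +oo[] has the
   same integral as []0, +oo[]. *)
by rewrite -Rintegral_itv_obnd_cbnd ?intS//; lra.
Qed.

(** The dominating function for integrals along a vertical line: [gamma_transform_decay] shows that
    Gamma decays at this rate. *)
Lemma integrable_oneDsqrV (K : R) :
  mu.-integrable [set: R] (fun t => (K * (1 + t ^+ 2)^-1)%:E).
Proof.
suff H : mu.-integrable [set: R] (EFin \o (fun t => (1 + t ^+ 2)^-1)).
  exact: (integrableZl measurableT K H).
apply/integrableP; split.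
  by apply/measurable_EFinP; apply: continuous_measurable_fun; exact: continuous_oneDsqrV.
under eq_integral do rewrite /= ger0_norm ?invr_ge0 ?addr_ge0 ?sqr_ge0//.
rewrite ge0_symfun_integralT.
- rewrite -set_itvcy; have := @integral0y_oneDsqr R; rewrite /oneDsqr => ->.
  by rewrite -EFinM ltry.
- by move=> x; rewrite invr_ge0 addr_ge0 ?sqr_ge0.
- exact: continuous_oneDsqrV.
- by move=> x /=; rewrite sqrrN.
Qed.

End symmetric_integrals.

(** * The Gamma function on a vertical line *)

Lemma is_derive_continuous {R : realType} (f : R -> R) (x df : R) :
  is_derive x (1 : R) f df -> {for x, continuous f}.
Proof.
move=> dF; apply: differentiable_continuous.
by apply/derivable1_diffP; exact: ex_derive.
Qed.

Section gamma_kernel.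
Context {R : realType}.
Notation mu := (@lebesgue_measure R).
Notation D := (`]0, +oo[%classic : set R).
Implicit Types (a b c t u w : R).

(** For [0 < u], the modulus of Euler's integrand [u ^ (s - 1) * exp (- u)] on the line
    [Re s = a]. *)
Definition gamma_kernel a u := u `^ (a - 1) * expR (- u).

Lemma gamma_kernel_ge0 a u : 0 <= gamma_kernel a u.
Proof. by rewrite mulr_ge0 ?powR_ge0 ?expR_ge0. Qed.

Lemma mulr_powRB1 a u : 0 < u -> u * u `^ (a - 1) = u `^ a.
Proof.
move=> u0; rewrite -[X in X * _](powRr1 (ltW u0)) -powRD.
  by rewrite addrC subrK.
by apply/implyP => _; rewrite gt_eqF.
Qed.

Lemma gamma_kernelS a u : 0 < u -> gamma_kernel (a + 1) u = u * gamma_kernel a u.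
Proof. by move=> u0; rewrite /gamma_kernel addrK mulrA mulr_powRB1. Qed.

Lemma measurable_gamma_kernel a : measurable_fun [set: R] (gamma_kernel a).
Proof.
apply: measurable_funM; first exact: measurable_powR.
by apply: measurableT_comp => //; exact: oppr_measurable.
Qed.

Lemma powR_le_expR b : 0 < b -> exists2 K, 0 < K &
  forall u, 0 < u -> u `^ b <= K * expR (u / 2).
Proof.
(* The constant is [(2 * b) ^ b]. It comes from [ln y <= y] at [y = u / (2 * b)], multiplied by
   [b]. *)
move=> b0; exists (expR (b * ln (2 * b))); first exact: expR_gt0.
move=> u u0; rewrite -expRD /powR gt_eqF// ler_expR.
have b20 : 0 < 2 * b by rewrite mulr_gt0.
have : ln (u / (2 * b)) <= u / (2 * b) by rewrite ltW// ln_sublinear// divr_gt0.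
rewrite ln_div ?posrE// -(ler_pM2l b0).
have -> : b * (u / (2 * b)) = u / 2 by field; rewrite gt_eqF.
by lra.
Qed.

(** A single comparison serves both ends of the half-line. The function [f] is the derivative of
    [- 1 / (1 + u ^ a)], which is bounded by 1, so [f] is integrable. From
    [1 + u ^ a <= (1 + K) * exp (u / 2)], squared, the kernel is at most [(1 + K) ^ 2 / a] times
    [f]. *)
Lemma integrable_gamma_kernel a : 0 < a -> mu.-integrable D (EFin \o gamma_kernel a).
Proof.
move=> a0.
pose F u : R := - (1 + u `^ a)^-1.
pose f u : R := a * u `^ (a - 1) / (1 + u `^ a) ^+ 2.
have p0 u : 0 < 1 + u `^ a by rewrite ltr_pwDl ?powR_ge0.
have intf : mu.-integrable D (EFin \o f).
  apply: (@integrable_derive_ge0 _ f F 0 1) => x x0.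
  - have ? := is_derive1_powR a x0.
    have ne0 : 1 + x `^ a != 0 by rewrite gt_eqF.
    rewrite /F /f; apply: is_derive_eq.
    by rewrite /GRing.scale/= add0r; field.
  - have ? := is_derive1_powR a x0; have ? := is_derive1_powR (a - 1) x0.
    have ne0 : (1 + x `^ a) ^+ 2 != 0 by rewrite gt_eqF// exprn_gt0.
    by apply: is_derive_continuous; rewrite /f.
  - by rewrite !mulr_ge0 ?powR_ge0 ?invr_ge0 ?sqr_ge0// ltW.
  - rewrite normrN normfV (ger0_norm (ltW (p0 x))) invf_le1//.
    by rewrite lerDl powR_ge0.
have [K K0 hK] := powR_le_expR a0.
apply: (@integrable_norm_le _ _ _ mu D _ (fun u => (1 + K) ^+ 2 / a * f u)) => //.
- exact: measurable_funTS (measurable_gamma_kernel a).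
- exact: (integrableZl _ ((1 + K) ^+ 2 / a) intf).
move=> u /=; rewrite in_itv/= andbT => u0.
rewrite ger0_norm ?gamma_kernel_ge0// /gamma_kernel /f.
have -> : (1 + K) ^+ 2 / a * (a * u `^ (a - 1) / (1 + u `^ a) ^+ 2) =
    u `^ (a - 1) * ((1 + K) ^+ 2 / (1 + u `^ a) ^+ 2).
  by field; rewrite !gt_eqF.
rewrite ler_wpM2l ?powR_ge0// expRN ler_pdivlMr ?exprn_gt0//.
rewrite mulrC ler_pdivrMr ?expR_gt0//.
have -> : expR u = expR (u / 2) ^+ 2 by rewrite -expRM_natr; congr expR; lra.
have le1 : 1 + u `^ a <= (1 + K) * expR (u / 2).
  rewrite mulrDl mul1r lerD ?hK//.
  by rewrite -[leLHS]expR0 ler_expR ltW// divr_gt0.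
rewrite -exprMn; apply: lerXn2r => //; rewrite nnegrE; first exact: ltW.
exact: le_trans (ltW (p0 u)) le1.
Qed.

(** The bound 4 is chosen to cover cosine and sine as well as the weight [atan y + pi / 2], whose
    values lie between 0 and [pi]. *)
Lemma cvg0_powR_expR a (h : R -> R) : 0 < a -> (forall u, `|h u| <= 4) ->
  u `^ a * expR (- u) * h u @[u --> 0^'+] --> (0 : R).
Proof.
move=> a0 h4.
apply/norm_cvg0P.
apply: (@squeeze_cvgr _ _ _ _ (cst 0) (fun u => u `^ a * 4)); last 2 first.
  exact: cvg_cst.
  by rewrite -[X in _ --> X](mul0r 4); apply: cvgMl; exact: powR_cvg0.
near=> u; rewrite normr_ge0/= !normrM ler_pM ?mulr_ge0//.
rewrite ger0_norm ?powR_ge0// ger0_norm ?expR_ge0// ler_piMr ?powR_ge0//.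
by rewrite -expR0 ler_expR oppr_le0.
Unshelve. all: by end_near. Qed.

Lemma cvgy_powR_expR a (h : R -> R) : 0 < a -> (forall u, `|h u| <= 4) ->
  u `^ a * expR (- u) * h u @[u --> +oo] --> (0 : R).
Proof.
move=> a0 h4; have [K K0 hK] := powR_le_expR a0.
apply/norm_cvg0P.
apply: (@squeeze_cvgr _ _ _ _ (cst 0) (fun u => K * expR (- (u / 2)) * 4)); last 2 first.
  exact: cvg_cst.
  rewrite -[X in _ --> X](mul0r 4); apply: cvgMl.
  rewrite -[X in _ --> X](mulr0 K); apply: cvgMr.
  apply: (cvg_comp (fun u : R => u / 2) (fun u => expR (- u))); last exact: cvgr_expR.
  by apply: gt0_cvgMly => //; exact: cvg_id.
near=> u; rewrite normr_ge0/= !normrM ler_pM ?mulr_ge0//.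
have u0 : 0 < u by [].
rewrite ger0_norm ?powR_ge0// ger0_norm ?expR_ge0//.
apply: (@le_trans _ _ (K * expR (u / 2) * expR (- u))).
  by rewrite ler_wpM2r ?expR_ge0 ?hK.
by rewrite -mulrA -expRD ler_pM2l// ler_expR; lra.
Unshelve. all: by end_near. Qed.

(* [Gamma (a + i t) * exp (- i c t) = gamma_cos a c t + i * gamma_sin a c t]. *)
Definition gamma_cos a c t :=
  \int[mu]_(u in D) (gamma_kernel a u * cos (t * (ln u - c))).
Definition gamma_sin a c t :=
  \int[mu]_(u in D) (gamma_kernel a u * sin (t * (ln u - c))).

Lemma cos_norm_le1 (x : R) : `|cos x| <= 1.
Proof. by rewrite ler_norml cos_geN1 cos_le1. Qed.

Lemma sin_norm_le1 (x : R) : `|sin x| <= 1.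
Proof. by rewrite ler_norml sin_geN1 sin_le1. Qed.

Lemma integrable_gamma_kernelM a (h : R -> R) : 0 < a ->
  measurable_fun [set: R] h -> (forall u, `|h u| <= 1) ->
  mu.-integrable D (EFin \o (fun u => gamma_kernel a u * h u)).
Proof.
move=> a0 mh h1.
apply: (@integrable_norm_le _ _ _ mu D _ (gamma_kernel a)) => //.
- apply: measurable_funTS; apply: measurable_funM => //.
  exact: measurable_gamma_kernel.
- exact: integrable_gamma_kernel.
- by move=> u _; rewrite normrM ger0_norm ?gamma_kernel_ge0// ler_piMr ?gamma_kernel_ge0.
Qed.

Lemma le_Rintegral_gamma_kernelM a (h : R -> R) : 0 < a ->
  measurable_fun [set: R] h -> (forall u, `|h u| <= 1) ->
  `|\int[mu]_(u in D) (gamma_kernel a u * h u)| <= \int[mu]_(u in D) gamma_kernel a u.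
Proof.
move=> a0 mh h1; have ih := integrable_gamma_kernelM a0 mh h1.
apply: (le_trans (le_normr_Rintegral _ ih)) => //.
apply: le_Rintegral => //.
- exact: (integrable_norm ih).
- exact: integrable_gamma_kernel.
- by move=> u _; rewrite normrM ger0_norm ?gamma_kernel_ge0// ler_piMr ?gamma_kernel_ge0.
Qed.

Lemma measurable_lnphase c t : measurable_fun [set: R] (fun u : R => t * (ln u - c)).
Proof.
by apply: measurable_funM => //; apply: measurable_funB => //; exact: measurable_ln.
Qed.

Lemma measurable_cos_lnphase c t :
  measurable_fun [set: R] (fun u : R => cos (t * (ln u - c))).
Proof.
apply: measurableT_comp (measurable_lnphase c t).
by apply: continuous_measurable_fun; exact: continuous_cos.
Qed.

Lemma measurable_sin_lnphase c t :
  measurable_fun [set: R] (fun u : R => sin (t * (ln u - c))).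
Proof.
apply: measurableT_comp (measurable_lnphase c t).
by apply: continuous_measurable_fun; exact: continuous_sin.
Qed.

(* The fundamental theorem of calculus for [u `^ a * expR (- u) * h u], which
   vanishes at both ends. *)
Lemma Rintegral_gamma_kernel_parts a (h dh : R -> R) : 0 < a ->
  (forall u, `|h u| <= 4) ->
  (forall u, 0 < u -> is_derive u (1 : R) h (u^-1 * dh u)) ->
  (forall u, 0 < u -> {for u, continuous dh}) ->
  mu.-integrable D (EFin \o (fun u => gamma_kernel a u * h u)) ->
  mu.-integrable D (EFin \o (fun u => gamma_kernel (a + 1) u * h u)) ->
  mu.-integrable D (EFin \o (fun u => gamma_kernel a u * dh u)) ->
  a * (\int[mu]_(u in D) (gamma_kernel a u * h u))
  - \int[mu]_(u in D) (gamma_kernel (a + 1) u * h u)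
  + \int[mu]_(u in D) (gamma_kernel a u * dh u) = 0.
Proof.
move=> a0 h4 dhE cdh i1 i2 i3.
have i1a : mu.-integrable D (EFin \o (fun u => a * (gamma_kernel a u * h u))).
  exact: (integrableZl _ a i1).
have i12 : mu.-integrable D (EFin \o (fun u => a * (gamma_kernel a u * h u) -
    gamma_kernel (a + 1) u * h u)).
  exact: (integrableB _ i1a i2).
rewrite -RintegralZl// -RintegralB// -RintegralD//.
transitivity ((0 : R) - 0); last by rewrite subrr.
apply: (@Rintegral_derive_itvoy _ _ (fun u => u `^ a * expR (- u) * h u)) => //.
- move=> u u0; have ? := is_derive1_powR a u0; have ? := dhE _ u0.
  apply: is_derive_eq.
  rewrite gamma_kernelS// /gamma_kernel /GRing.scale/=.
  rewrite -(mulr_powRB1 a u0).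
  by field; rewrite gt_eqF.
- move=> u u0; have ? := is_derive1_powR (a - 1) u0.
  have ? := is_derive1_powR (a + 1 - 1) u0; have ? := dhE _ u0.
  apply: continuousD; last first.
    by apply: continuousM (cdh _ u0); apply: is_derive_continuous; rewrite /gamma_kernel.
  by apply: is_derive_continuous; rewrite /gamma_kernel.
- exact: (integrableD _ i12 i3).
- exact: cvg0_powR_expR.
- exact: cvgy_powR_expR.
Qed.

(** Real part of the functional equation [Gamma (s + 1) = s * Gamma s] at [s = a + i t], with both
    sides multiplied by the phase [exp (- i c t)]. *)
Lemma gamma_sin_parts a c t : 0 < a ->
  t * gamma_sin a c t = a * gamma_cos a c t - gamma_cos (a + 1) c t.
Proof.
move=> a0; have a10 : 0 < a + 1 by rewrite addr_gt0.
have iS := integrable_gamma_kernelM a0 (measurable_sin_lnphase c t) (fun=> sin_norm_le1 _).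
have E : \int[mu]_(u in D) (gamma_kernel a u * (- t * sin (t * (ln u - c)))) =
    - t * gamma_sin a c t.
  by under eq_Rintegral do rewrite mulrCA; rewrite RintegralZl.
have := @Rintegral_gamma_kernel_parts a (fun u => cos (t * (ln u - c)))
  (fun u => - t * sin (t * (ln u - c))) a0.
rewrite E -!/(gamma_cos _ _ _) => H.
apply/eqP; rewrite -subr_eq0 -oppr_eq0 opprB -mulNr; apply/eqP; apply: H.
- by move=> u; rewrite (le_trans (cos_norm_le1 _))// ler1n.
- move=> u u0; have ? := is_derive1_ln u0; apply: is_derive_eq.
  by rewrite /GRing.scale/=; ring.
- by move=> u u0; have ? := is_derive1_ln u0; apply: is_derive_continuous.
- exact: integrable_gamma_kernelM a0 (measurable_cos_lnphase c t) (fun=> cos_norm_le1 _).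
- exact: integrable_gamma_kernelM a10 (measurable_cos_lnphase c t) (fun=> cos_norm_le1 _).
- rewrite (_ : _ \o _ = EFin \o (fun u => - t * (gamma_kernel a u * sin (t * (ln u - c))))); last first.
    by apply/funext => u /=; rewrite mulrCA.
  exact: (integrableZl _ (- t) iS).
Qed.

(** Imaginary part of the same functional equation. *)
Lemma gamma_cos_parts a c t : 0 < a ->
  t * gamma_cos a c t = gamma_sin (a + 1) c t - a * gamma_sin a c t.
Proof.
move=> a0; have a10 : 0 < a + 1 by rewrite addr_gt0.
have iC := integrable_gamma_kernelM a0 (measurable_cos_lnphase c t) (fun=> cos_norm_le1 _).
have E : \int[mu]_(u in D) (gamma_kernel a u * (t * cos (t * (ln u - c)))) =
    t * gamma_cos a c t.
  by under eq_Rintegral do rewrite mulrCA; rewrite RintegralZl.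
have := @Rintegral_gamma_kernel_parts a (fun u => sin (t * (ln u - c)))
  (fun u => t * cos (t * (ln u - c))) a0.
rewrite E -!/(gamma_sin _ _ _) => H.
apply/eqP; rewrite -subr_eq0 opprB addrC; apply/eqP; apply: H.
- by move=> u; rewrite (le_trans (sin_norm_le1 _))// ler1n.
- move=> u u0; have ? := is_derive1_ln u0; apply: is_derive_eq.
  by rewrite /GRing.scale/=; ring.
- by move=> u u0; have ? := is_derive1_ln u0; apply: is_derive_continuous.
- exact: integrable_gamma_kernelM a0 (measurable_sin_lnphase c t) (fun=> sin_norm_le1 _).
- exact: integrable_gamma_kernelM a10 (measurable_sin_lnphase c t) (fun=> sin_norm_le1 _).
- rewrite (_ : _ \o _ = EFin \o (fun u => t * (gamma_kernel a u * cos (t * (ln u - c))))); last first.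
    by apply/funext => u /=; rewrite mulrCA.
  exact: (integrableZl _ t iC).
Qed.

Lemma gamma_transform_bounded a : 0 < a -> exists M, forall c t,
  `|gamma_cos a c t| <= M /\ `|gamma_sin a c t| <= M.
Proof.
move=> a0; exists (\int[mu]_(u in D) gamma_kernel a u) => c t; split.
- exact: le_Rintegral_gamma_kernelM a0 (measurable_cos_lnphase c t) (fun=> cos_norm_le1 _).
- exact: le_Rintegral_gamma_kernelM a0 (measurable_sin_lnphase c t) (fun=> sin_norm_le1 _).
Qed.

(** The three relations combine to [t ^ 2 * x0 = - a ^ 2 * x0 + (2 * a + 1) * x1 - x2]. Hence
    [(1 + t ^ 2) * x0] is a linear combination of bounded quantities. *)
Let parts_decay a t x0 x1 x2 y0 y1 M0 M1 M2 : 0 < a ->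
  t * x0 = y1 - a * y0 -> t * y0 = a * x0 - x1 -> t * y1 = (a + 1) * x1 - x2 ->
  `|x0| <= M0 -> `|x1| <= M1 -> `|x2| <= M2 ->
  `|x0| <= (M0 + a ^+ 2 * M0 + (2 * a + 1) * M1 + M2) * (1 + t ^+ 2)^-1.
Proof.
move=> a0 e0 e1 e2; have t2 : 0 < 1 + t ^+ 2 by rewrite ltr_pwDl ?sqr_ge0.
move=> h0 h1 h2; rewrite ler_pdivlMr// mulrC -[X in X * _](gtr0_norm t2) -normrM.
have -> : (1 + t ^+ 2) * x0 = x0 - a ^+ 2 * x0 + (2 * a + 1) * x1 - x2.
  by rewrite mulrDl mul1r expr2 -mulrA e0 mulrBr mulrCA e2 e1; ring.
have a2 : 0 <= a ^+ 2 by rewrite sqr_ge0.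
have a21 : 0 <= 2 * a + 1 by lra.
move: h0 h1 h2; rewrite !ler_norml => /andP[l0 r0] /andP[l1 r1] /andP[l2 r2].
have := ler_wpM2l a2 l0; have := ler_wpM2l a2 r0.
have := ler_wpM2l a21 l1; have := ler_wpM2l a21 r1.
by move=> *; apply/andP; split; lra.
Qed.

(** Two uses of the functional equation trade boundedness at [a], [a + 1] and [a + 2] for quadratic
    decay at [a]. The constant does not depend on [c], which later makes it a bound uniform in the
    second variable of a double integral. *)
Lemma gamma_transform_decay a : 0 < a -> exists K, forall c t,
  `|gamma_cos a c t| <= K * (1 + t ^+ 2)^-1 /\ `|gamma_sin a c t| <= K * (1 + t ^+ 2)^-1.
Proof.
move=> a0; have a10 : 0 < a + 1 by rewrite addr_gt0.
have a20 : 0 < a + 1 + 1 by rewrite addr_gt0.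
have [M0 h0] := gamma_transform_bounded a0.
have [M1 h1] := gamma_transform_bounded a10.
have [M2 h2] := gamma_transform_bounded a20.
exists (M0 + a ^+ 2 * M0 + (2 * a + 1) * M1 + M2) => c t.
have [c0 s0] := h0 c t; have [c1 s1] := h1 c t; have [c2 s2] := h2 c t.
have eC0 := gamma_cos_parts c t a0; have eS0 := gamma_sin_parts c t a0.
have eC1 := gamma_cos_parts c t a10; have eS1 := gamma_sin_parts c t a10.
split; first exact: (parts_decay a0 eC0 eS0 eS1).
(* The pair (sine, minus cosine) satisfies the same relations as (cosine, sine), because it arises
   from multiplying the transform by [- i]. *)
apply: (@parts_decay a t _ _ _ (- gamma_cos a c t) (- gamma_cos (a + 1) c t)
  _ _ _ a0 _ _ _ s0 s1 s2).
- by rewrite eS0 mulrN opprK addrC.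
- by rewrite mulrN eC0 opprB.
- by rewrite mulrN eC1 opprB.
Qed.

End gamma_kernel.

(** * Mellin inversion for the exponential *)

Section cahen_mellin.
Context {R : realType}.
Notation mu := (@lebesgue_measure R).
Notation D := (`]0, +oo[%classic : set R).
Implicit Types (a b c e t u w : R).

(** [gamma_kernel a] dominates the integrand for every [t], so continuity passes under the integral
    sign. *)
Lemma continuous_gamma_transform a c (h : R -> R) : 0 < a ->
  continuous h -> (forall x, `|h x| <= 1) ->
  continuous (fun t => \int[mu]_(u in D) (gamma_kernel a u * h (t * (ln u - c)))).
Proof.
move=> a0 ch h1 t0.
have mh t : measurable_fun [set: R] (fun u : R => h (t * (ln u - c))).
  apply: measurableT_comp (measurable_lnphase c t).
  exact: continuous_measurable_fun.
apply: (@continuity_under_integral _ _ _ mu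
  (fun t u => gamma_kernel a u * h (t * (ln u - c))) D _ (t0 - 1) (t0 + 1) _ _ (gamma_kernel a)) => //.
- by move=> t _; apply: integrable_gamma_kernelM.
- apply: aeW => u _ t _ /=; apply: cvgM; first exact: cvg_cst.
  apply: (cvg_comp (fun t => t * (ln u - c)) h); last exact: ch.
  by apply: cvgM; [exact: cvg_id|exact: cvg_cst].
- exact: integrable_gamma_kernel.
- move=> t _; apply: aeW => u _.
  by rewrite normrM ger0_norm ?gamma_kernel_ge0// ler_piMr ?gamma_kernel_ge0.
- by apply/mem_set; rewrite /= in_itv/=; apply/andP; lra.
Qed.

Lemma continuous_gamma_cos a c : 0 < a -> continuous (gamma_cos a c).
Proof.
move=> a0; apply: continuous_gamma_transform => //; first exact: continuous_cos.
exact: cos_norm_le1.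
Qed.

Lemma continuous_gamma_sin a c : 0 < a -> continuous (gamma_sin a c).
Proof.
move=> a0; apply: continuous_gamma_transform => //; first exact: continuous_sin.
exact: sin_norm_le1.
Qed.

Lemma integrable_gamma_cos a c : 0 < a -> mu.-integrable D (EFin \o gamma_cos a c).
Proof.
move=> a0; have [K hK] := gamma_transform_decay a0.
apply: (@integrable_norm_le _ _ _ mu D _ (fun t => K * (1 + t ^+ 2)^-1)) => //.
- by apply: measurable_funTS; apply: continuous_measurable_fun; exact: continuous_gamma_cos.
- by apply: (@integrableS _ _ _ mu setT) => //; exact: integrable_oneDsqrV.
- by move=> t _; case: (hK c t).
Qed.

Lemma integrable_expRN e : 0 < e -> mu.-integrable D (EFin \o (fun t => expR (- (e * t)))).
Proof.
move=> e0; apply: (@integrable_derive_ge0 _ _ (fun t => - (e^-1 * expR (- (e * t)))) 0 e^-1).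
- move=> t t0; apply: is_derive_eq; rewrite /GRing.scale/=.
  by field; rewrite gt_eqF.
- by move=> t t0; apply: is_derive_continuous.
- by move=> t t0; exact: expR_ge0.
- move=> t t0; have ei0 : 0 < e^-1 by rewrite invr_gt0.
  rewrite normrN normrM (gtr0_norm ei0) (gtr0_norm (expR_gt0 _)) ger_pMr//.
  by rewrite -expR0 ler_expR oppr_le0 mulr_ge0// ltW.
Qed.

Lemma expRM_cvgy0 e (h : R -> R) M : 0 < e -> (forall t, `|h t| <= M) ->
  expR (- (e * t)) * h t @[t --> +oo] --> (0 : R).
Proof.
move=> e0 hM; apply/norm_cvg0P.
apply: (@squeeze_cvgr _ _ _ _ (cst 0) (fun t => expR (- (e * t)) * M)); last 2 first.
  exact: cvg_cst.
  rewrite -[X in _ --> X](mul0r M); apply: cvgMl.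
  apply: (cvg_comp (fun t => e * t) (fun t => expR (- t))); last exact: cvgr_expR.
  by apply: gt0_cvgMry => //; exact: cvg_id.
near=> t; rewrite normr_ge0/= normrM ger0_norm ?expR_ge0//.
by rewrite ler_wpM2l ?expR_ge0.
Unshelve. all: by end_near. Qed.

Lemma integrable_laplace_cos e b : 0 < e ->
  mu.-integrable D (EFin \o (fun t => expR (- (e * t)) * cos (t * b))).
Proof.
move=> e0.
apply: (@integrable_norm_le _ _ _ mu D _ (fun t => expR (- (e * t)))) => //.
- apply: measurable_funTS; apply: continuous_measurable_fun => t.
  exact: is_derive_continuous.
- exact: integrable_expRN.
- move=> t _; rewrite normrM ger0_norm ?expR_ge0//.
  by rewrite ler_piMr ?expR_ge0// cos_norm_le1.
Qed.

(** The Laplace transform of the cosine, a Poisson kernel in [b] up to the factor [pi]. *)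
Lemma laplace_cos e b : 0 < e ->
  \int[mu]_(t in D) (expR (- (e * t)) * cos (t * b)) = e / (e ^+ 2 + b ^+ 2).
Proof.
move=> e0; have eb0 : 0 < e ^+ 2 + b ^+ 2 by rewrite ltr_pwDl ?sqr_ge0 ?exprn_gt0.
(* Chosen so that [exp (- e t) * h t] is an antiderivative of the integrand; it vanishes at
   infinity, so only [- h 0] remains. *)
pose h t : R := (b * sin (t * b) - e * cos (t * b)) / (e ^+ 2 + b ^+ 2).
have h0 : h 0 = - (e / (e ^+ 2 + b ^+ 2)).
  by rewrite /h !mul0r sin0 cos0 mulr0 mulr1 sub0r mulNr.
transitivity (0 - h 0); last by rewrite h0 sub0r opprK.
apply: (@Rintegral_derive_itvoy _ _ (fun t => expR (- (e * t)) * h t)).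
- move=> t t0; rewrite /h; apply: is_derive_eq; rewrite /GRing.scale/=.
  by field; rewrite gt_eqF.
- by move=> t t0; apply: is_derive_continuous.
- exact: integrable_laplace_cos.
- have : {for 0, continuous (fun t => expR (- (e * t)) * h t)}.
    by apply: is_derive_continuous; rewrite /h.
  move=> /cvg_at_right_filter; rewrite mulr0 oppr0 expR0 mul1r; exact.
- apply: (@expRM_cvgy0 _ _ ((`|b| + e) / (e ^+ 2 + b ^+ 2))) => // t.
  rewrite /h normrM [X in _ * X <= _]ger0_norm ?invr_ge0 ?(ltW eb0)//.
  rewrite ler_pM2r ?invr_gt0// (le_trans (ler_normB _ _))// !normrM (gtr0_norm e0).
  apply: lerD; first by rewrite ler_piMr// sin_norm_le1.
  by rewrite ler_piMr ?cos_norm_le1// ltW.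
Qed.

Lemma measurable_gamma_phase a c (h : R -> R) : continuous h ->
  measurable_fun [set: measurableTypeR R * measurableTypeR R]
    (fun z => gamma_kernel a z.2 * h (z.1 * (ln z.2 - c))).
Proof.
move=> ch; apply: measurable_funM.
  by apply: measurableT_comp; [exact: measurable_gamma_kernel|exact: measurable_snd].
apply: (measurableT_comp (continuous_measurable_fun ch)).
apply: measurable_funM; first exact: measurable_fst.
apply: measurable_funB => //.
by apply: measurableT_comp; [exact: measurable_ln|exact: measurable_snd].
Qed.

(** The damping factor gives the product bound [exp (- e t) * gamma_kernel a u], which is integrable
    in both variables. The integrals may then be exchanged, and the one in [t] is [laplace_cos]. *)
Lemma abel_gamma_cos a c e : 0 < a -> 0 < e ->
  \int[mu]_(t in D) (expR (- (e * t)) * gamma_cos a c t) =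
  \int[mu]_(u in D) (gamma_kernel a u * (e / (e ^+ 2 + (ln u - c) ^+ 2))).
Proof.
move=> a0 e0.
pose f (z : measurableTypeR R * measurableTypeR R) : R :=
  expR (- (e * z.1)) * (gamma_kernel a z.2 * cos (z.1 * (ln z.2 - c))).
have mf : measurable_fun [set: measurableTypeR R * measurableTypeR R] f.
  apply: measurable_funM; last exact: (@measurable_gamma_phase a c cos (@continuous_cos R)).
  have mE : measurable_fun [set: R] (fun t : R => expR (- (e * t))).
    by apply: continuous_measurable_fun => t; apply: is_derive_continuous.
  by apply: (measurableT_comp mE); exact: measurable_fst.
have fgh (x y : R) : D x -> D y -> `|f (x, y)| <= expR (- (e * x)) * gamma_kernel a y.
  move=> _ _; rewrite /f/= normrM ger0_norm ?expR_ge0// ler_wpM2l ?expR_ge0//.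
  by rewrite normrM ger0_norm ?gamma_kernel_ge0// ler_piMr ?gamma_kernel_ge0// cos_norm_le1.
have := @Rintegral_exchange R _ _ (measurableTypeR R) (measurableTypeR R) mu mu D D f
  (fun t => expR (- (e * t))) (gamma_kernel a) (measurable_itv _) (measurable_itv _) mf
  (integrable_expRN e0) (integrable_gamma_kernel a0) fgh.
rewrite /f/= => H.
transitivity (\int[mu]_(t in D) \int[mu]_(u in D)
    (expR (- (e * t)) * (gamma_kernel a u * cos (t * (ln u - c))))).
  apply: eq_Rintegral => t _.
  have iC := integrable_gamma_kernelM a0 (measurable_cos_lnphase c t)
    (fun=> cos_norm_le1 _).
  by rewrite (RintegralZl (mu := mu) _ _ iC); last exact: measurable_itv.
rewrite H; apply: eq_Rintegral => u _; rewrite -(laplace_cos (ln u - c) e0).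
rewrite -(RintegralZl (mu := mu) _ _ (integrable_laplace_cos (ln u - c) e0)).
  by apply: eq_Rintegral => t _; exact: mulrCA.
exact: measurable_itv.
Qed.

End cahen_mellin.

Section mellin_barnes_real.
Context {R : realType}.
Notation mu := (@lebesgue_measure R).
Notation D := (`]0, +oo[%classic : set R).
Implicit Types (a c e t u v w x : R).

(** The Poisson kernel divided by [u] is the derivative of [atan ((ln u - c) / e)]. Integration by
    parts moves the derivative to [u ^ a * exp (- u)], which vanishes at both ends. The added
    constant [pi / 2] makes the weight tend to 0 on the side [u < exp c] as [e] tends to 0. *)
Lemma abel_gamma_cos_parts a c e : 0 < a -> 0 < e ->
  \int[mu]_(u in D) (gamma_kernel a u * (e / (e ^+ 2 + (ln u - c) ^+ 2))) =
  \int[mu]_(u in D) ((gamma_kernel (a + 1) u - a * gamma_kernel a u) *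
                     (atan ((ln u - c) / e) + pi / 2)).
Proof.
move=> a0 e0; have a10 : 0 < a + 1 by rewrite addr_gt0.
pose h u : R := atan ((ln u - c) / e) + pi / 2.
pose dh u : R := e / (e ^+ 2 + (ln u - c) ^+ 2).
have h4 u : `|h u| <= 4.
  have := atan_gtNpi2 ((ln u - c) / e); have := atan_ltpi2 ((ln u - c) / e).
  have := @pihalf_lt2 R; rewrite /h ler_norml => ? ? ?; apply/andP; split; lra.
have ec0 u : 0 < e ^+ 2 + (ln u - c) ^+ 2 by rewrite ltr_pwDl ?sqr_ge0 ?exprn_gt0.
have mln : measurable_fun [set: R] (fun u : R => ln u - c).
  by apply: measurable_funB => //; exact: measurable_ln.
have mh : measurable_fun [set: R] h.
  apply: measurable_funD => //.
  apply: (measurableT_comp (continuous_measurable_fun _)) => //.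
    by move=> y; exact: continuous_atan.
  by apply: measurable_funM.
have ih b : 0 < b -> mu.-integrable D (EFin \o (fun u => gamma_kernel b u * h u)).
  move=> b0; apply: (@integrable_norm_le _ _ _ mu D _ (fun u => 4 * gamma_kernel b u)) => //.
  - by apply: measurable_funTS; apply: measurable_funM => //; exact: measurable_gamma_kernel.
  - exact: (integrableZl _ 4 (integrable_gamma_kernel b0)).
  - by move=> u _; rewrite normrM (ger0_norm (gamma_kernel_ge0 _ _)) mulrC ler_wpM2r ?gamma_kernel_ge0.
have mdh : measurable_fun [set: R] dh.
  have m1 : measurable_fun [set: R] (fun y : R => e / (e ^+ 2 + y ^+ 2)).
    apply: continuous_measurable_fun => y.
    have ne0 : e ^+ 2 + y ^+ 2 != 0 by rewrite gt_eqF// ltr_pwDl ?sqr_ge0 ?exprn_gt0.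
    by apply: is_derive_continuous.
  exact: (measurableT_comp m1 mln).
have idh : mu.-integrable D (EFin \o (fun u => gamma_kernel a u * dh u)).
  apply: (@integrable_norm_le _ _ _ mu D _ (fun u => e^-1 * gamma_kernel a u)) => //.
  - by apply: measurable_funTS; apply: measurable_funM => //; exact: measurable_gamma_kernel.
  - exact: (integrableZl _ e^-1 (integrable_gamma_kernel a0)).
  - move=> u _; rewrite normrM (ger0_norm (gamma_kernel_ge0 _ _)) mulrC ler_wpM2r ?gamma_kernel_ge0//.
    rewrite /dh ger0_norm ?divr_ge0 ?(ltW e0) ?(ltW (ec0 _))//.
    rewrite ler_pdivrMr// mulrDr expr2 mulKf ?gt_eqF// lerDl.
    by rewrite mulr_ge0 ?sqr_ge0// invr_ge0 ltW.
have := @Rintegral_gamma_kernel_parts _ a h dh a0 h4 _ _ (ih _ a0) (ih _ a10) idh.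
have -> : \int[mu]_(u in D) ((gamma_kernel (a + 1) u - a * gamma_kernel a u) * h u) =
    \int[mu]_(u in D) (gamma_kernel (a + 1) u * h u) -
    a * \int[mu]_(u in D) (gamma_kernel a u * h u).
  rewrite -RintegralZl ?ih// -RintegralB//; first by apply: eq_Rintegral => u _; ring.
  - exact: ih.
  - exact: (integrableZl _ a (ih _ a0)).
move=> H; have : forall A B C : R, A - B + C = 0 -> C = B - A by move=> *; lra.
apply; apply: H => u u0.
- have ? := is_derive1_ln u0; rewrite /h /dh; apply: is_derive_eq.
  by rewrite /GRing.scale/=; field; rewrite !gt_eqF.
- have ? := is_derive1_ln u0; have := lt0r_neq0 (ec0 u) => ?.
  by apply: is_derive_continuous; rewrite /dh.
Qed.

(* Mellin inversion at [w = expR c] for the transform [Gamma] of [expR (- u)].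
   As [e] tends to [0], the weight [atan ((ln u - c) / e) + pi / 2] of the previous
   lemma tends to [pi] times the indicator of [u > w]. *)
Lemma Rintegral_gamma_cos a c : 0 < a ->
  \int[mu]_(t in D) gamma_cos a c t = pi * (expR c `^ a * expR (- expR c)).
Proof.
move=> a0; have a10 : 0 < a + 1 by rewrite addr_gt0.
pose w := expR c; have w0 : 0 < w by exact: expR_gt0.
(* This is minus the derivative of [u ^ a * exp (- u)]. *)
pose q u : R := gamma_kernel (a + 1) u - a * gamma_kernel a u.
pose e n : R := n.+1%:R^-1; have e0 n : 0 < e n by rewrite invr_gt0.
have iq : mu.-integrable D (EFin \o q).
  exact: (integrableB _ (integrable_gamma_kernel a10)
    (integrableZl _ a (integrable_gamma_kernel a0))).
have mq : measurable_fun [set: R] q.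
  apply: measurable_funB; first exact: measurable_gamma_kernel.
  by apply: measurable_funM => //; exact: measurable_gamma_kernel.
(* First evaluation of the limit: the damping factor tends to 1, and the integrable function
   [|gamma_cos a c|] dominates. *)
have L : \int[mu]_(t in D) (expR (- (e n * t)) * gamma_cos a c t) @[n --> \oo] -->
    \int[mu]_(t in D) gamma_cos a c t.
  have mC : measurable_fun D (gamma_cos a c).
    by apply: measurable_funTS; apply: continuous_measurable_fun; exact: continuous_gamma_cos.
  apply: (@dominated_cvg_Rintegral _ _ _ mu D
    (fun n t => expR (- (e n * t)) * gamma_cos a c t) (gamma_cos a c) (fun t => `|gamma_cos a c t|)) => //.
  - move=> n; apply: measurable_funM => //; apply: measurable_funTS.
    by apply: continuous_measurable_fun => t; apply: is_derive_continuous.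
  - apply: aeW => t _; rewrite -[X in _ --> X]mul1r; apply: cvgMl.
    have -> : (1 : R) = expR (- (0 * t)) by rewrite mul0r oppr0 expR0.
    apply: (cvg_comp (fun n => - (e n * t)) expR); last exact: continuous_expR.
    by apply: cvgN; apply: cvgMl; exact: cvg_harmonic.
  - exact: (integrable_norm (integrable_gamma_cos c a0)).
  - move=> n t; rewrite /= in_itv/= andbT => t0; rewrite normrM ger0_norm ?expR_ge0//.
    by rewrite ler_piMl// -expR0 ler_expR oppr_le0 mulr_ge0 ?(ltW (e0 n))// ltW.
have {}L : \int[mu]_(u in D) (q u * (atan ((ln u - c) / e n) + pi / 2)) @[n --> \oo] -->
    \int[mu]_(t in D) gamma_cos a c t.
  apply: cvg_trans L; apply: near_eq_cvg; near=> n.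
  by rewrite abel_gamma_cos// abel_gamma_cos_parts.
(* Second evaluation of the same limit, after the exchange and the integration by parts; the weight
   stays between 0 and [pi], so [4 * |q|] dominates. *)
have L' : \int[mu]_(u in D) (q u * (atan ((ln u - c) / e n) + pi / 2)) @[n --> \oo] -->
    \int[mu]_(u in D) ((fun u => q u * pi) \_ (`]w, +oo[%classic : set R)) u.
  apply: (@dominated_cvg_Rintegral _ _ _ mu D
    (fun n u => q u * (atan ((ln u - c) / e n) + pi / 2)) _ (fun u => 4 * `|q u|)) => //.
  - move=> n; apply: measurable_funTS; apply: measurable_funM => //.
    apply: measurable_funD => //.
    apply: (measurableT_comp (continuous_measurable_fun _)) => //.
      by move=> y; exact: continuous_atan.
    by apply: measurable_funM => //; apply: measurable_funB => //; exact: measurable_ln.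
  - apply: measurable_funTS; apply: (measurable_restrictT _ (measurable_itv _)).1.
    by apply: measurable_funTS; apply: measurable_funM.
  (* At [u = w] the weight is [pi / 2] for every [n]; this single point is the exceptional null
     set. *)
  - exists [set w]; split => //; first exact: lebesgue_measure_set1.
    move=> u /= /not_implyP[]; rewrite in_itv/= andbT => u0 H.
    apply: contrapT => /eqP uw; apply: H.
    have einf (s : R) : 0 < s -> s / e n @[n --> \oo] --> +oo.
      move=> s0; rewrite (_ : (fun n => s / e n) = (fun n => s * n.+1%:R)); last first.
        by apply/funext => n; rewrite /e invrK.
      have hn : n.+1%:R @[n --> \oo] --> (+oo : set_system R).
        by have := @cvgr_idn R; rewrite -cvg_shiftS.
      apply: (cvg_comp _ (fun y => s * y) hn).
      by apply: gt0_cvgMry => //; exact: cvg_id.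
    rewrite patchE; case: ifPn.
      move=> /set_mem; rewrite /= in_itv/= andbT => wu.
      have s0 : 0 < ln u - c by rewrite subr_gt0 -ltr_expR lnK.
      apply: cvgMr; rewrite [X in _ --> X](splitr pi); apply: cvgD; last exact: cvg_cst.
      exact: (cvg_comp _ (@atan R) (einf _ s0) (@cvgy_atan R)).
    move=> /negP wu; have s0 : 0 < c - ln u.
      rewrite subr_gt0 -ltr_expR lnK// lt_neqAle uw/= leNgt; apply/negP => wu'.
      by apply: wu; apply/mem_set; rewrite /= in_itv/= wu'.
    (* Outside []w, +oo[] the restricted function takes the default value [point], which is 0 in
       [R]; it is rewritten as the limit of the weighted product. *)
    have -> : (point : R) = q u * (- (pi / 2) + pi / 2) by rewrite addNr mulr0.
    apply: cvgMr; apply: cvgD; last exact: cvg_cst.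
    have -> : (fun n => atan ((ln u - c) / e n)) = (fun n => - atan ((c - ln u) / e n)).
      by apply/funext => n; rewrite -atanN -mulNr opprB.
    by apply: cvgN; exact: (cvg_comp _ (@atan R) (einf _ s0) (@cvgy_atan R)).
  - exact: (integrableZl _ 4 (integrable_norm iq)).
  - move=> n u _; rewrite normrM mulrC ler_wpM2r//.
    have := atan_gtNpi2 ((ln u - c) / e n); have := atan_ltpi2 ((ln u - c) / e n).
    by have := @pihalf_lt2 R; rewrite ler_norml => ? ? ?; apply/andP; split; lra.
rewrite (cvg_unique (@Rhausdorff R) L L').
rewrite -Rintegral_mkcondr setIidr; last first.
  by move=> u; rewrite /= !in_itv/= !andbT; exact: lt_trans.
have iqw : mu.-integrable (`]w, +oo[%classic : set R) (EFin \o q).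
  apply: (@integrableS _ _ _ mu D) => //.
  by move=> u; rewrite /= !in_itv/= !andbT; exact: lt_trans.
rewrite RintegralZr// mulrC; congr (_ * _).
transitivity (0 - - (w `^ a * expR (- w))); last by rewrite sub0r opprK.
apply: (@Rintegral_derive_itvoy _ _ (fun u => - (u `^ a * expR (- u)))) => //.
- move=> u wu; have u0 := lt_trans w0 wu; have ? := is_derive1_powR a u0.
  apply: is_derive_eq; rewrite /q gamma_kernelS// /gamma_kernel /GRing.scale/=.
  by rewrite -(mulr_powRB1 a u0); ring.
- move=> u wu; have u0 := lt_trans w0 wu; have ? := is_derive1_powR (a - 1) u0.
  have ? := is_derive1_powR (a + 1 - 1) u0.
  by apply: is_derive_continuous; rewrite /q /gamma_kernel.
- apply: cvg_at_right_filter.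
  have ? := is_derive1_powR a w0.
  have : {for w, continuous (fun u => - (u `^ a * expR (- u)))} by apply: is_derive_continuous.
  exact.
- rewrite -oppr0; apply: cvgN.
  have := @cvgy_powR_expR _ a (fun=> 1) a0; under eq_fun do rewrite mulr1.
  by apply => _; rewrite normr1 ler1n.
Unshelve. all: by end_near. Qed.

End mellin_barnes_real.

(** * The Mellin-Barnes integral of Gamma s * Gamma (1 - s) *)

Section mellin_barnes_pair.
Context {R : realType}.
Notation mu := (@lebesgue_measure R).
Notation D := (`]0, +oo[%classic : set R).
Implicit Types (a c t u v x : R).

Lemma gamma_cosN a c t : gamma_cos a c (- t) = gamma_cos a c t.
Proof. by apply: eq_Rintegral => u _; rewrite mulNr cosN. Qed.

Lemma gamma_sinN a c t : 0 < a -> gamma_sin a c (- t) = - gamma_sin a c t.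
Proof.
move=> a0; rewrite -[RHS]mulN1r /gamma_sin -RintegralZl//; last first.
  exact: integrable_gamma_kernelM a0 (measurable_sin_lnphase c t) (fun=> sin_norm_le1 _).
by apply: eq_Rintegral => u _; rewrite mulNr sinN mulrN mulN1r.
Qed.

(** Real part of [exp (- i c t) * Gamma (a + i t)]. Isolating the dependence on [c] makes joint
    measurability in [t] and [c] visible. *)
Lemma gamma_cos_shift a c t : 0 < a ->
  gamma_cos a c t = cos (t * c) * gamma_cos a 0 t + sin (t * c) * gamma_sin a 0 t.
Proof.
move=> a0.
have iC := integrable_gamma_kernelM a0 (measurable_cos_lnphase 0 t) (fun=> cos_norm_le1 _).
have iS := integrable_gamma_kernelM a0 (measurable_sin_lnphase 0 t) (fun=> sin_norm_le1 _).
rewrite /gamma_cos /gamma_sin -!RintegralZl// -RintegralD//; last 2 first.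
  exact: (integrableZl _ _ iC).
  exact: (integrableZl _ _ iS).
apply: eq_Rintegral => u _; rewrite subr0 mulrBr cosB; ring.
Qed.

(* Real and imaginary parts of [Gamma s * Gamma (1 - s) * x ^ s] at [s = a + i t]. *)
Definition mellin_re a x t :=
  x `^ a * ((gamma_cos a 0 t * gamma_cos (1 - a) 0 t + gamma_sin a 0 t * gamma_sin (1 - a) 0 t)
            * cos (t * ln x)
          + (gamma_sin a 0 t * gamma_cos (1 - a) 0 t - gamma_cos a 0 t * gamma_sin (1 - a) 0 t)
            * - sin (t * ln x)).

Definition mellin_im a x t :=
  x `^ a * ((gamma_cos a 0 t * gamma_cos (1 - a) 0 t + gamma_sin a 0 t * gamma_sin (1 - a) 0 t)
            * sin (t * ln x)
          + (gamma_sin a 0 t * gamma_cos (1 - a) 0 t - gamma_cos a 0 t * gamma_sin (1 - a) 0 t)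
            * cos (t * ln x)).

(** Decay of one Gamma factor and boundedness of the other suffice. The constant [4 * K * M] counts
    the four products. *)
Lemma integrable_gamma_product a (C S : R -> R) : 0 < a < 1 ->
  continuous C -> continuous S -> (forall t, `|C t| <= 1) -> (forall t, `|S t| <= 1) ->
  mu.-integrable [set: R] (EFin \o (fun t =>
    (gamma_cos a 0 t * gamma_cos (1 - a) 0 t + gamma_sin a 0 t * gamma_sin (1 - a) 0 t) * C t
    + (gamma_sin a 0 t * gamma_cos (1 - a) 0 t - gamma_cos a 0 t * gamma_sin (1 - a) 0 t) * S t)).
Proof.
move=> /andP[a0 a1] cC cS C1 S1; have b0 : 0 < 1 - a by rewrite subr_gt0.
have [K hK] := gamma_transform_decay a0.
have [M hM] := gamma_transform_bounded b0.
have cc := @continuous_gamma_cos R a 0 a0; have cs := @continuous_gamma_sin R a 0 a0.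
have cc' := @continuous_gamma_cos R (1 - a) 0 b0; have cs' := @continuous_gamma_sin R (1 - a) 0 b0.
apply: (@integrable_norm_le _ _ _ mu _ _ (fun t => (4 * K * M) * (1 + t ^+ 2)^-1)) => //.
- apply: continuous_measurable_fun => t; apply: cvgD; apply: cvgM; try exact: cC; try exact: cS.
  + by apply: cvgD; apply: cvgM; [exact: cc|exact: cc'|exact: cs|exact: cs'].
  + by apply: cvgB; apply: cvgM; [exact: cs|exact: cc'|exact: cc|exact: cs'].
- exact: integrable_oneDsqrV.
move=> t _; have [kc ks] := hK 0 t; have [mc ms] := hM 0 t.
set k := K * _ in kc ks.
have -> : 4 * K * M * (1 + t ^+ 2)^-1 = (k * M + k * M) * 1 + (k * M + k * M) * 1.
  by rewrite /k; ring.
rewrite (le_trans (ler_normD _ _))// lerD// normrM ler_pM//.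
  by rewrite (le_trans (ler_normD _ _))// lerD// normrM ler_pM.
by rewrite (le_trans (ler_normB _ _))// lerD// normrM ler_pM.
Qed.

Let continuous_cosM x : continuous (fun t => cos (t * ln x)).
Proof. by move=> t; apply: is_derive_continuous. Qed.

Let continuous_sinM x : continuous (fun t => sin (t * ln x)).
Proof. by move=> t; apply: is_derive_continuous. Qed.

Lemma integrable_mellin_re a x : 0 < a < 1 -> mu.-integrable [set: R] (EFin \o mellin_re a x).
Proof.
move=> a01; have cS : continuous (fun t => - sin (t * ln x)).
  by move=> t; apply: is_derive_continuous.
have S1 t : `|- sin (t * ln x)| <= 1 by rewrite normrN sin_norm_le1.
exact: (integrableZl measurableT (x `^ a) (integrable_gamma_product a01
  (@continuous_cosM x) cS (fun=> cos_norm_le1 _) S1)).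
Qed.

Lemma integrable_mellin_im a x : 0 < a < 1 -> mu.-integrable [set: R] (EFin \o mellin_im a x).
Proof.
move=> a01; exact: (integrableZl measurableT (x `^ a) (integrable_gamma_product a01
  (@continuous_sinM x) (@continuous_cosM x) (fun=> sin_norm_le1 _) (fun=> cos_norm_le1 _))).
Qed.

(** Conjugation symmetry of the integrand makes its imaginary part odd in [t]. *)
Lemma Rintegral_mellin_im a x : 0 < a < 1 -> \int[mu]_t mellin_im a x t = 0.
Proof.
move=> a01; apply: Rintegral_odd; first exact: integrable_mellin_im.
case/andP : a01 => a0 a1 t; have b0 : 0 < 1 - a by rewrite subr_gt0.
rewrite /mellin_im !gamma_cosN !gamma_sinN// (mulNr t) cosN sinN.
move: (gamma_cos a 0 t) (gamma_sin a 0 t) (gamma_cos (1 - a) 0 t) (gamma_sin (1 - a) 0 t).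
by move: (x `^ a) (cos _) (sin _) => *; ring.
Qed.

(** With [Gamma (1 - s)] written as an integral over [v], the factor [v ^ (- s) * x ^ s] is
    [(v / x) ^ (- s)]; its phase is absorbed as the shift [c = ln v - ln x] of the transform of
    [Gamma s]. *)
Lemma mellin_re_integral a x t : 0 < a < 1 ->
  mellin_re a x t =
  x `^ a * \int[mu]_(v in D) (gamma_kernel (1 - a) v * gamma_cos a (ln v - ln x) t).
Proof.
move=> /andP[a0 a1]; have b0 : 0 < 1 - a by rewrite subr_gt0.
have iC := integrable_gamma_kernelM b0 (measurable_cos_lnphase 0 t) (fun=> cos_norm_le1 _).
have iS := integrable_gamma_kernelM b0 (measurable_sin_lnphase 0 t) (fun=> sin_norm_le1 _).
rewrite /mellin_re; congr (_ * _).
under [RHS]eq_Rintegral do rewrite gamma_cos_shift//.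
set C := gamma_cos a 0 t; set S := gamma_sin a 0 t.
transitivity ((C * cos (t * ln x) - S * sin (t * ln x)) * gamma_cos (1 - a) 0 t
  + (C * sin (t * ln x) + S * cos (t * ln x)) * gamma_sin (1 - a) 0 t).
  by ring.
rewrite /gamma_cos /gamma_sin -!RintegralZl// -RintegralD//; last 2 first.
  exact: (integrableZl _ _ iC).
  exact: (integrableZl _ _ iS).
apply: eq_Rintegral => v _.
by rewrite subr0 mulrBr cosB sinB; ring.
Qed.

Lemma Rintegral_mellin_re a x : 0 < a < 1 -> 0 < x ->
  \int[mu]_t mellin_re a x t = 2 * pi / (1 + x^-1).
Proof.
move=> a01 x0; case/andP : (a01) => a0 a1; have b0 : 0 < 1 - a by rewrite subr_gt0.
rewrite Rintegral_even//; last 2 first.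
- exact: integrable_mellin_re.
- move=> t; rewrite /mellin_re !gamma_cosN !gamma_sinN// (mulNr t) cosN sinN.
  move: (gamma_cos a 0 t) (gamma_sin a 0 t) (gamma_cos (1 - a) 0 t) (gamma_sin (1 - a) 0 t).
  by move: (x `^ a) (cos _) (sin _) => *; ring.
rewrite -mulrA; congr (_ * _).
under eq_Rintegral do rewrite mellin_re_integral//.
have [K hK] := gamma_transform_decay a0.
pose f (z : measurableTypeR R * measurableTypeR R) : R :=
  gamma_kernel (1 - a) z.2 * (cos (z.1 * (ln z.2 - ln x)) * gamma_cos a 0 z.1
    + sin (z.1 * (ln z.2 - ln x)) * gamma_sin a 0 z.1).
have fE t v : gamma_kernel (1 - a) v * gamma_cos a (ln v - ln x) t = f (t, v).
  by rewrite (gamma_cos_shift (ln v - ln x)).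
have mf : measurable_fun [set: measurableTypeR R * measurableTypeR R] f.
  have -> : f = (fun z => gamma_kernel (1 - a) z.2 * cos (z.1 * (ln z.2 - ln x)) * gamma_cos a 0 z.1
    + gamma_kernel (1 - a) z.2 * sin (z.1 * (ln z.2 - ln x)) * gamma_sin a 0 z.1).
    by apply/funext => z; rewrite /f; ring.
  apply: measurable_funD; apply: measurable_funM.
  - exact: (@measurable_gamma_phase _ _ _ cos (@continuous_cos R)).
  - apply: (measurableT_comp (continuous_measurable_fun (@continuous_gamma_cos R a 0 a0))).
    exact: measurable_fst.
  - exact: (@measurable_gamma_phase _ _ _ sin (@continuous_sin R)).
  - apply: (measurableT_comp (continuous_measurable_fun (@continuous_gamma_sin R a 0 a0))).
    exact: measurable_fst.
have fgh (t v : R) : D t -> D v -> `|f (t, v)| <= K * (1 + t ^+ 2)^-1 * gamma_kernel (1 - a) v.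
  move=> _ _; rewrite -fE normrM (ger0_norm (gamma_kernel_ge0 _ _)) mulrC.
  by rewrite ler_wpM2r ?gamma_kernel_ge0//; case: (hK (ln v - ln x) t).
have iK : mu.-integrable D (EFin \o (fun t => K * (1 + t ^+ 2)^-1)).
  by apply: (@integrableS _ _ _ mu setT) => //; exact: integrable_oneDsqrV.
have exch := @Rintegral_exchange R _ _ (measurableTypeR R) (measurableTypeR R) mu mu D D f
  _ _ (measurable_itv _) (measurable_itv _) mf iK (integrable_gamma_kernel b0) fgh.
have isec := @integrable_Rintegral_section R _ _ (measurableTypeR R) (measurableTypeR R) mu mu D D f
  _ _ (measurable_itv _) (measurable_itv _) mf iK (integrable_gamma_kernel b0) fgh.
transitivity (x `^ a * \int[mu]_(t in D) \int[mu]_(v in D) f (t, v)).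
  rewrite -(RintegralZl (mu := mu) (x `^ a) _ isec); last exact: measurable_itv.
  apply: eq_Rintegral => t _; congr (_ * _).
  by apply: eq_Rintegral => v _; exact: fE.
rewrite exch.
have x1 : 0 < 1 + x^-1 by rewrite addr_gt0 ?invr_gt0.
(* Mellin inversion at [c = ln v - ln x] gives [pi * (v / x) ^ a * exp (- v / x)]. Its power of [v]
   cancels the one in [gamma_kernel (1 - a) v], leaving a pure exponential. *)
transitivity (x `^ a * \int[mu]_(v in D) (x `^ (- a) * pi * expR (- ((1 + x^-1) * v)))).
  congr (_ * _); apply: eq_Rintegral => v /set_mem; rewrite /= in_itv/= andbT => v0.
  transitivity (gamma_kernel (1 - a) v * \int[mu]_(t in D) gamma_cos a (ln v - ln x) t).
    have iC := @integrable_gamma_cos R a (ln v - ln x) a0.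
    rewrite -(RintegralZl (mu := mu) _ _ iC); last exact: measurable_itv.
    by apply: eq_Rintegral => t _; symmetry; exact: fE.
  rewrite (Rintegral_gamma_cos _ a0).
  have -> : expR (ln v - ln x) = v / x by rewrite expRB !lnK.
  have -> : (v / x) `^ a = v `^ a * x `^ (- a).
    have xV0 : 0 <= x^-1 by rewrite invr_ge0 ltW.
    by rewrite (powRM a (ltW v0) xV0) -(powR_inv1 (ltW x0)) -powRrM mulN1r.
  have -> : gamma_kernel (1 - a) v = (v `^ a)^-1 * expR (- v).
    by rewrite /gamma_kernel -powRN; congr (_ `^ _ * _); ring.
  have -> : expR (- ((1 + x^-1) * v)) = expR (- v) * expR (- (v / x)).
    by rewrite -expRD; congr expR; ring.
  have := lt0r_neq0 (powR_gt0 a v0).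
  move: (v `^ a) (x `^ (- a)) (expR (- v)) (expR (- (v / x))) (pi : R) => p1 p2 p3 p4 p5 p0.
  by field.
rewrite (RintegralZl (mu := mu) _ _ (integrable_expRN x1)); last exact: measurable_itv.
have -> : \int[mu]_(v in D) expR (- ((1 + x^-1) * v)) = (1 + x^-1)^-1.
  (* The remaining exponential integral is the Laplace transform of the cosine at frequency 0. *)
  have := laplace_cos 0 x1; under eq_Rintegral do rewrite mulr0 cos0 mulr1.
  move=> ->; move: (1 + x^-1) (lt0r_neq0 x1) => y y0.
  by rewrite [0 ^+ 2]expr2 mul0r; field.
rewrite powRN; move: (x `^ a) (lt0r_neq0 (powR_gt0 a x0)) => p p0.
by move: (1 + x^-1) (lt0r_neq0 x1) (pi : R) => y y0 p'; field; rewrite p0 y0.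
Qed.

End mellin_barnes_pair.

(** * Factorization of the iterated integral *)

Section complex_line_integrals.
Context {R : realType}.
Notation mu := (@lebesgue_measure R).
Notation D := (`]0, +oo[%classic : set R).
Implicit Types (a t x : R) (z : R[i]).

Lemma complexM (a b c d : R) :
  Complex a b * Complex c d = Complex (a * c - b * d) (a * d + b * c).
Proof. by []. Qed.

Lemma cpowE x a t : 0 < x ->
  cpow x (Complex a t) = Complex (x `^ a * cos (t * ln x)) (x `^ a * sin (t * ln x)).
Proof.
move=> x0; rewrite /cpow complexM /cexp /= !mulr0 subr0 add0r.
by rewrite /powR gt_eqF.
Qed.

Lemma Gamma_EulerE a t : 0 < a ->
  Gamma_Euler (Complex a t) = Complex (gamma_cos a 0 t) (gamma_sin a 0 t).
Proof.
move=> a0; rewrite /Gamma_Euler /cintegral.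
have -> : Complex a t - 1 = Complex (a - 1) t by rewrite -[t in RHS]subr0.
have E u : 0 < u -> cpow u (Complex (a - 1) t) * (expR (- u))%:C%C =
    Complex (gamma_kernel a u * cos (t * (ln u - 0))) (gamma_kernel a u * sin (t * (ln u - 0))).
  move=> u0; rewrite cpowE// complexM !mulr0 subr0 add0r subr0 /gamma_kernel.
  by congr Complex; ring.
by congr Complex; apply: eq_Rintegral => u /set_mem uD;
  rewrite E//; move: uD; rewrite /= in_itv/= andbT.
Qed.

Lemma cGammaE a t : 0 < a -> cGamma (Complex a t) = Complex (gamma_cos a 0 t) (gamma_sin a 0 t).
Proof.
by move=> a0; rewrite /cGamma /= a0 big_ord0 addr0 divr1 Gamma_EulerE.
Qed.

Lemma foxH_kernel_cpowE a x t : 0 < a < 1 -> 0 < x ->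
  foxH_kernel (1%N, 1%N) [:: (1, 1)] [:: (1, 1)] (Complex a t) * cpow x (Complex a t) =
  Complex (mellin_re a x t) (mellin_im a x t).
Proof.
move=> /andP[a0 a1] x0; have b0 : 0 < 1 - a by rewrite subr_gt0.
rewrite /foxH_kernel /= !big_seq1 !big_nil mulr1 divr1 /= mul1r subrr add0r.
have -> : 1 - Complex a t = Complex (1 - a) (- t) by rewrite -[- t in RHS]add0r.
rewrite !cGammaE// gamma_cosN gamma_sinN// cpowE// !complexM.
rewrite /mellin_re /mellin_im.
move: (gamma_cos a 0 t) (gamma_sin a 0 t) (gamma_cos (1 - a) 0 t) (gamma_sin (1 - a) 0 t).
by move: (x `^ a) (cos _) (sin _) => *; congr Complex; ring.
Qed.

(** Both components are required together, since multiplication by a complex constant mixes them. *)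
Definition line_integrable (sigma : R) (f : R[i] -> R[i]) :=
  mu.-integrable [set: R] (fun t => (complex.Re (f (Complex sigma t)))%:E) /\
  mu.-integrable [set: R] (fun t => (complex.Im (f (Complex sigma t)))%:E).

Lemma vline_integralZl sigma (f : R[i] -> R[i]) z : line_integrable sigma f ->
  vline_integral sigma (fun s => z * f s) = z * vline_integral sigma f.
Proof.
move=> [ir ii]; rewrite /vline_integral mulrCA; congr (_ * _).
case: z => b c; rewrite /cintegral.
have i1 (k : R) := integrableZl measurableT k ir.
have i2 (k : R) := integrableZl measurableT k ii.
rewrite complexM -!RintegralZl// -RintegralB//; last 2 first.
  exact: i1.
  exact: i2.
rewrite -RintegralD//; last 2 first.
  exact: i2.
  exact: i1.
by congr Complex; apply: eq_Rintegral => t _; case: (f _).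
Qed.

(** Induction on [L]. The free factor [z] lets the induction hypothesis absorb [g ord0 s0], which is
    constant for the inner integrals; the outermost integral is then linear in it. *)
Lemma iter_vline_integral_prod L (sigma : 'I_L -> R) (g : 'I_L -> R[i] -> R[i]) z :
  (forall l, line_integrable (sigma l) (g l)) ->
  iter_vline_integral sigma (fun s => z * \prod_(l < L) g l (s l)) =
  z * \prod_(l < L) vline_integral (sigma l) (g l).
Proof.
elim: L sigma g z => [|L IH] sigma g z ig /=; first by rewrite !big_ord0.
transitivity (vline_integral (sigma ord0) (fun s0 =>
    (z * \prod_(l < L) vline_integral (sigma (lift ord0 l)) (g (lift ord0 l))) * g ord0 s0)).
  congr vline_integral; apply/funext => s0.
  rewrite mulrAC -(IH (fun l => sigma (lift ord0 l)) (fun l => g (lift ord0 l))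
    (z * g ord0 s0)); last by move=> l; exact: ig.
  congr (iter_vline_integral _ _); apply/funext => s.
  rewrite big_ord_recl unlift_none/= mulrA; congr (_ * _).
  by apply: eq_bigr => l _; rewrite liftK.
by rewrite vline_integralZl// big_ord_recl mulrA mulrAC mulrA.
Qed.

Lemma line_integrable_foxH_kernel a x : 0 < a < 1 -> 0 < x ->
  line_integrable a (fun s => foxH_kernel (1%N, 1%N) [:: (1, 1)] [:: (1, 1)] s * cpow x s).
Proof.
move=> a01 x0; split.
- under eq_fun do rewrite foxH_kernel_cpowE//=; exact: integrable_mellin_re.
- under eq_fun do rewrite foxH_kernel_cpowE//=; exact: integrable_mellin_im.
Qed.

Lemma vline_integral_foxH_kernel a x : 0 < a < 1 -> 0 < x ->
  vline_integral a (fun s => foxH_kernel (1%N, 1%N) [:: (1, 1)] [:: (1, 1)] s * cpow x s) =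
  ((2 * pi)%:C * 'i * (1 / (1 + x^-1))%:C)%C.
Proof.
move=> a01 x0; rewrite /vline_integral.
rewrite (_ : (fun t => _) = (fun t => Complex (mellin_re a x t) (mellin_im a x t))); last first.
  by apply/funext => t; exact: foxH_kernel_cpowE.
rewrite /cintegral /=.
rewrite Rintegral_mellin_re// Rintegral_mellin_im// !complexM.
by congr Complex; rewrite /=; ring.
Qed.

(** The coupling factor consists of empty products and equals 1. Each line integral contributes
    [2 pi i / (1 + 1 / x)], and the prefactor [(2 pi i) ^- L] cancels the powers of [2 pi i]. *)
Lemma foxH_one_oneE L (sigma x : 'I_L -> R) :
  (forall l, 0 < sigma l < 1) -> (forall l, 0 < x l) ->
  foxH 0 (fun=> (1%N, 1%N)) [::] (fun=> [:: (1, 1)]) [::] (fun=> [:: (1, 1)]) sigma x =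
  (\prod_(l < L) (1 / (1 + (x l)^-1)))%:C%C.
Proof.
move=> hs hx; rewrite /foxH /foxH_coupling.
pose g l s := foxH_kernel (1%N, 1%N) [:: (1, 1)] [:: (1, 1)] s * cpow (x l) s.
rewrite [iter_vline_integral _ _](_ : _ =
    iter_vline_integral sigma (fun s => 1 * \prod_(l < L) g l (s l))); last first.
  congr (iter_vline_integral _ _); apply/funext => s.
  by rewrite /= !big_nil mulr1 divr1.
rewrite iter_vline_integral_prod => [|l]; last exact: line_integrable_foxH_kernel.
under eq_bigr do rewrite vline_integral_foxH_kernel//.
rewrite big_split/= prodr_const card_ord mul1r mulKf ?rmorph_prod//.
rewrite expf_neq0// mulf_neq0//.
  by rewrite eq_complex/= eqxx andbT mulf_neq0// gt_eqF// pi_gt0.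
by rewrite eq_complex/= oner_eq0 andbF.
Qed.

End complex_line_integrals.

(** * Outage probability of selection combining *)

Lemma probability_selection_combining d (T : measurableType d) (R : realType)
    (P : probability T R) L (X : 'I_L -> {RV P >-> R}) (r : R) :
  mutually_independent X -> 0 <= r ->
  P [set t | selection_combining (fun l => X l : T -> R) t <= r] =
  (\prod_(l < L) cdf (X l) r)%E.
Proof.
move=> indep r0.
have -> : [set t | selection_combining (fun l => X l : T -> R) t <= r] =
    \bigcap_(l in [set` [set: 'I_L]%SET]) (X l @^-1` `]-oo, r]).
  apply/seteqP; split => t /=; rewrite /selection_combining.
    move=> h l _ /=; rewrite in_itv/=; apply: le_trans h.
    by rewrite (bigmaxD1 l)//= le_max lexx.
  (* The iterated maximum starts from 0, so the bound [0 <= r] is used here along with the bounds on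
     the branches. *)
  move=> h; apply/bigmax_leP; split => // l _.
  by have := h l; rewrite /= inE in_itv/=; apply.
by rewrite (indep _ (fun=> `]-oo, r]%classic)); [apply: eq_bigl => l; rewrite inE|].
Qed.

Theorem mainTheorem6 (d : measure_display) (T : measurableType d)
    (R : realType) (P : probability T R)
    (L : nat) (hL : (0 < L)%N)
    (rho gth : R) (hrho : 0 < rho) (hgth : 0 < gth)
    (alpha beta : 'I_L -> R)
    (halpha : forall l, 0 < alpha l) (hbeta : forall l, 0 < beta l)
    (gam : 'I_L -> {RV P >-> R})
    (hindep : mutually_independent gam)
    (hnonneg : forall l t, 0 <= gam l t)
    (hcdf : forall l g, 0 < g ->
      cdf (gam l) g = (1 / (1 + (g / (rho * alpha l)) `^ (- beta l)))%:E) :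
  let gamSC := selection_combining (fun l => gam l : T -> R) in
  let Pout := P [set t | gamSC t <= gth] in
  (forall sigma : 'I_L -> R, (forall l, 0 < sigma l < 1) ->
    (fine Pout)%:C%C =
      foxH 0 (fun=> (1%N, 1%N))
        [::] (fun=> [:: (1, 1)])
        [::] (fun=> [:: (1, 1)])
        sigma (fun l => (gth / (rho * alpha l)) `^ beta l))
  /\
  (forall a b : R, (forall l, alpha l = a) -> (forall l, beta l = b) ->
    Pout = (1 / (1 + (gth / (rho * a)) `^ (- b)) ^+ L)%:E).
Proof.
move=> gamSC Pout.
(* Independence reduces both claims to this product of distribution functions. *)
have PoutE : Pout = (\prod_(l < L) (1 / (1 + (gth / (rho * alpha l)) `^ (- beta l))))%:E.
  rewrite /Pout /gamSC probability_selection_combining ?(ltW hgth)// -prodEFin.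
  by apply: eq_bigr => l _; rewrite hcdf.
split => [sigma hsigma|a b ha hb].
  rewrite foxH_one_oneE//; last first.
    by move=> l; rewrite powR_gt0 ?divr_gt0 ?mulr_gt0.
  (* The factor [1 / (1 + x^-1)] of the H-function matches the distribution function because the
     inverse of a power is the power with opposite exponent. *)
  by rewrite PoutE /=; congr (_%:C)%C; apply: eq_bigr => l _; rewrite powRN.
rewrite PoutE; congr EFin.
under eq_bigr do rewrite ha hb.
by rewrite prodr_const card_ord expr_div_n expr1n.
Qed.
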